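(* (1) Let $n\ge 3$ and $I^n=[0,1]^n$. There exist smooth isotopies $\{\xi_t\}_{t\in[0,1]}$ and $\{\eta_t\}_{t\in[0,1]}$ in $\mathrm{SDiff}(I^n)$ such that $\eta_0=\xi_0=\mathrm{id}$, $\eta_1=\xi_1$, $J(\{\xi_t\}_{t\in[0,1]})=\infty$ and $J(\{\eta_t\}_{t\in[0,1]})<\infty$. (2) In fact, let $(M,g)$ be a compact Riemannian manifold-with-boundary (possibly $\partial M=\emptyset$) such that $\dim M\ge 3$, $H_1(M;\mathbb{R})\neq\{0\}$, and the fundamental group $\pi_1(M)$ has trivial centre. Let $n\ge\dim M$ and let $\iota:(M,g)\hookrightarrow\mathbb{E}^n$ be a smooth isometric embedding. Let $\{\rho_j\}_{j\ge1}$ be any sequence of positive numbers with $\rho_j\to0$, and let $x_j\in I^n$ be such that the Euclidean balls $\mathbf{B}_j=\mathbf{B}_{\rho_j}(x_j)$ are pairwise disjoint, contained in $I^n$, and do not accumulate at any point of the interior of $I^n$. For each $j$ let $\iota_j:M\hookrightarrow\mathbf{B}_{\rho_j/2}(x_j)$ be an embedding obtained from $\iota$ by composing with a homothety and a translation of $\mathbb{E}^n$. Let $\{\delta_j\}_{j\ge1}$ be any sequence of positive numbers with $\delta_j<\rho_j/4$ such that the $\delta_j$-tubular neighbourhood $\mathcal{T}_{\delta_j}(\iota_j(M))$ is embedded for every $j$. Then there exist smooth isotopies $\{\xi_t\}_{t\in[0,1]}$ and $\{\eta_t\}_{t\in[0,1]}$ in $\mathrm{SDiff}(I^n)$ with $\eta_0=\xi_0=\mathrm{id}$,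 $\eta_1=\xi_1$, $J(\{\xi_t\}_{t\in[0,1]})=\infty$ and $J(\{\eta_t\}_{t\in[0,1]})<\infty$, such that in addition: (a) $\{\xi_t\}_{t\in[0,1]}$ is supported on $\bigcup_{j\ge1}\mathcal{T}_{\delta_j}(\iota_j(M))$; (b) for every $j$, the restriction of $\{\xi_t\}_{t\in[0,1]}$ to $\mathbf{B}_j$ never comes to a stop and never returns to a previous configuration: for every $t\in[0,1]$ the velocity $\frac{\partial\xi_t}{\partial t}$ does not vanish identically on $\mathbf{B}_j$, and for all $0\le s<t\le1$ one has $\xi_s|_{\mathbf{B}_j}\neq\xi_t|_{\mathbf{B}_j}$.
   Context: $\mathbb{E}^n$ is $\mathbb{R}^n$ with the Euclidean metric, and $\mathbf{B}_r(x)$ is the open Euclidean ball of radius $r$ centred at $x$. $\mathrm{SDiff}(I^n)$ is the group of orientation-preserving, boundary-preserving (mapping $\partial I^n$ to itself) diffeomorphisms of $I^n$ that preserve Lebesgue measure. By convention, elements of $\mathrm{SDiff}(I^n)$ are smooth diffeomorphisms in the interior of $I^n$ and are only assumed to be continuous (homeomorphic) up to the boundary $\partial I^n$. A smooth isotopy in $\mathrm{SDiff}(I^n)$ is a smooth curve $[0,1]\ni t\mapsto\xi_t\in\mathrm{SDiff}(I^n)$ with $\xi_0=\mathrm{id}$; smoothness is understood in the interior of $I^n$, i.e. $(t,x)\mapsto\xi_t(x)$ is smooth for $t\in[0,1]$ and $x$ in the interior of $I^n$. Its action (total kinetic energy) is $$J(\{\xi_t\}_{t\in[0,1]}):=\frac12\int_0^1\left\|\frac{\partial\xi_t}{\partial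 t}\right\|_{L^2(I^n)}^2\,dt=\frac12\int_0^1\int_{I^n}\left|\frac{\partial\xi_t(x)}{\partial t}\right|^2dx\,dt\in[0,\infty].$$ An isotopy $\{\xi_t\}_{t\in[0,1]}$ is supported on a set $\mathcal{K}$ if $\xi_t=\mathrm{id}$ outside $\mathcal{K}$ for all $t\in[0,1]$. For a compact embedded submanifold (possibly with boundary) $N\subset\mathbb{E}^n$ and $\delta>0$, the $\delta$-tubular neighbourhood is $\mathcal{T}_\delta(N)=\{y+\nu:\ y\in N,\ \nu\in(T_yN)^{\perp},\ |\nu|<\delta\}$; it is said to be embedded if the map $(y,\nu)\mapsto y+\nu$ from the $\delta$-disc bundle of the normal bundle of $N$ to $\mathbb{E}^n$ is a smooth embedding. *)

(* Defs.v *)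
From HB Require Import structures.
From mathcomp Require Import all_boot all_order all_algebra.
From mathcomp Require Import all_classical all_reals all_analysis.
Set Implicit Arguments.
Unset Strict Implicit.
Unset Printing Implicit Defensive.
Import Order.TTheory GRing.Theory Num.Theory.
Import numFieldNormedType.Exports.
Local Open Scope classical_set_scope.
Local Open Scope ring_scope.

(* The topology and the derivatives of the library on 'rV[R]_n come from the
   sup norm; the metric notions below use the Euclidean norm. *)

Definition dotv (R : realType) n (u v : 'rV[R]_n) : R := \sum_i u 0 i * v 0 i.

Definition enorm (R : realType) n (v : 'rV[R]_n) : R := Num.sqrt (dotv v v).

Definition eball (R : realType) n (x : 'rV[R]_n) (r : R) : set 'rV[R]_n :=
  [set y | enorm (y - x) < r].

(* Class C^k on an open set U: all partial derivatives of order at most k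
   exist and are continuous. *)
Fixpoint Ck (R : realType) m (V : normedModType R) (k : nat)
    (U : set 'rV[R]_m) (f : 'rV[R]_m -> V) : Prop :=
  (forall x, U x -> {for x, continuous f}) /\
  (if k is k'.+1 then
     forall i : 'I_m, (forall x, U x -> derivable f x (delta_mx 0 i)) /\
                      Ck k' U (fun x => 'D_(delta_mx 0 i) f x)
   else True).

(* On an arbitrary subset A of R^m, a map is smooth if it extends locally to a
   smooth map on an open set; the values of f outside A are irrelevant. *)
Definition smooth_on (R : realType) m (V : normedModType R)
    (A : set 'rV[R]_m) (f : 'rV[R]_m -> V) : Prop :=
  forall x, A x -> exists U (F : 'rV[R]_m -> V),
    [/\ open U, U x, forall k, Ck k U F & {in A `&` U, f =1 F}].

(* Smooth embedding of a subset of R^m in R^k: a diffeomorphism onto its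
   image. *)
Definition smooth_embedding_on (R : realType) m k (A : set 'rV[R]_m)
    (f : 'rV[R]_m -> 'rV[R]_k) : Prop :=
  smooth_on A f /\
  exists2 g : 'rV[R]_k -> 'rV[R]_m, smooth_on (f @` A) g & {in A, cancel f g}.

(* Jacobian matrix (acting on row vectors from the right, as 'J f x) of the
   restriction of f to A. It is only used where A is relatively open in a half
   space, so that there is at most one such matrix. *)
Definition jacobian_within (R : realType) m k (A : set 'rV[R]_m)
    (f : 'rV[R]_m -> 'rV[R]_k) (x : 'rV[R]_m) : 'M[R]_(m, k) :=
  xget 0 [set L : 'M[R]_(m, k) | forall e : R, 0 < e ->
    \forall y \near within A (nbhs x),
      `|f y - f x - (y - x) *m L| <= e * `|y - x|].

Definition half_space (R : realType) d : set 'rV[R]_d :=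
  [set x | forall i : 'I_d, val i = 0%N -> 0 <= x 0 i].

Record chart (R : realType) d (M : Type) := Chart {
  chart_dom : set M;
  chart_map : M -> 'rV[R]_d;
  chart_inv : 'rV[R]_d -> M
}.

Definition chart_img (R : realType) d M (c : chart R d M) : set 'rV[R]_d :=
  chart_map c @` chart_dom c.

Definition is_chart (R : realType) d (M : topologicalType) (c : chart R d M) :=
  [/\ open (chart_dom c),
      (exists2 V : set 'rV[R]_d, open V &
         chart_img c = V `&` @half_space R d),
      {in chart_dom c, cancel (chart_map c) (chart_inv c)},
      {within chart_dom c, continuous (chart_map c)} &
      {within chart_img c, continuous (chart_inv c)}].

Definition transition_dom (R : realType) d M (c c' : chart R d M) :
    set 'rV[R]_d :=
  chart_map c @` (chart_dom c `&` chart_dom c').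

Definition transition (R : realType) d M (c c' : chart R d M) :
    'rV[R]_d -> 'rV[R]_d :=
  chart_map c' \o chart_inv c.

(* The metric tensor is given by its Gram matrices: metric c p is the matrix of
   g at p in the coordinates of the chart c. *)
Record riemannian_manifold (R : realType) (d : nat) := RiemannianManifold {
  carrier :> topologicalType;
  atlas : set (chart R d carrier);
  metric : chart R d carrier -> carrier -> 'M[R]_d;
  carrier_hausdorff : hausdorff_space carrier;
  carrier_second_countable : @second_countable carrier;
  atlas_chart : forall c, atlas c -> is_chart c;
  atlas_cover : forall p : carrier, exists2 c, atlas c & chart_dom c p;
  atlas_smooth : forall c c', atlas c -> atlas c' ->
    smooth_on (transition_dom c c') (transition c c');
  metric_sym : forall c p, atlas c -> chart_dom c p ->
    (metric c p)^T = metric c p;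
  metric_pos : forall c p (v : 'rV[R]_d), atlas c -> chart_dom c p ->
    v != 0 -> 0 < (v *m metric c p *m v^T) 0 0;
  metric_smooth : forall c, atlas c ->
    smooth_on (chart_img c) (fun x => metric c (chart_inv c x));
  metric_transition : forall c c' p, atlas c -> atlas c' ->
    chart_dom c p -> chart_dom c' p ->
    let L := jacobian_within (transition_dom c c') (transition c c')
               (chart_map c p) in
    metric c p = L *m metric c' p *m L^T
}.

Definition chart_jacobian (R : realType) d n (M : riemannian_manifold R d)
    (f : M -> 'rV[R]_n) (c : chart R d M) (p : M) : 'M[R]_(d, n) :=
  jacobian_within (chart_img c) (f \o chart_inv c) (chart_map c p).

Definition smooth_embedding (R : realType) d n (M : riemannian_manifold R d)
    (f : M -> 'rV[R]_n) : Prop :=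
  [/\ continuous f, injective f,
      (forall U : set M, open U ->
         exists2 V : set 'rV[R]_n, open V & f @` U = V `&` range f),
      (forall c, atlas c -> smooth_on (chart_img c) (f \o chart_inv c)) &
      (forall c p, atlas c -> chart_dom c p -> \rank (chart_jacobian f c p) = d)].

Definition isometric (R : realType) d n (M : riemannian_manifold R d)
    (f : M -> 'rV[R]_n) : Prop :=
  forall c p, atlas c -> chart_dom c p ->
    metric c p = chart_jacobian f c p *m (chart_jacobian f c p)^T.

Definition tangent_space (R : realType) d n (M : riemannian_manifold R d)
    (f : M -> 'rV[R]_n) (p : M) : set 'rV[R]_n :=
  [set v | exists c (w : 'rV[R]_d),
     [/\ atlas c, chart_dom c p & v = w *m chart_jacobian f c p]].

(* The pair (y, nu) is encoded as row_mx y nu. *)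
Definition normal_disc_bundle (R : realType) d n (M : riemannian_manifold R d)
    (f : M -> 'rV[R]_n) (delta : R) : set 'rV[R]_(n + n) :=
  [set z | exists p : M,
     [/\ lsubmx z = f p,
         forall v, tangent_space f p v -> dotv (rsubmx z) v = 0 &
         enorm (rsubmx z) < delta]].

Definition normal_exp (R : realType) n (z : 'rV[R]_(n + n)) : 'rV[R]_n :=
  lsubmx z + rsubmx z.

Definition tube (R : realType) d n (M : riemannian_manifold R d)
    (f : M -> 'rV[R]_n) (delta : R) : set 'rV[R]_n :=
  @normal_exp R n @` normal_disc_bundle f delta.

Definition tube_embedded (R : realType) d n (M : riemannian_manifold R d)
    (f : M -> 'rV[R]_n) (delta : R) : Prop :=
  smooth_embedding_on (normal_disc_bundle f delta) (@normal_exp R n).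

Definition is_loop (R : realType) (T : topologicalType) (x : T) (a : R -> T) :=
  [/\ {within `[0, 1], continuous a}, a 0 = x & a 1 = x].

Definition loop_mul (R : realType) (T : Type) (a b : R -> T) : R -> T :=
  fun t => if t <= 2^-1 then a (2 * t) else b (2 * t - 1).

Definition loop_homotopic (R : realType) (T : topologicalType) (x : T)
    (a b : R -> T) : Prop :=
  exists H : R * R -> T,
    [/\ {within `[0, 1]%classic `*` `[0, 1]%classic, continuous H},
        (forall t, 0 <= t <= 1 -> H (0, t) = a t),
        (forall t, 0 <= t <= 1 -> H (1, t) = b t) &
        (forall s, 0 <= s <= 1 -> H (s, 0) = x /\ H (s, 1) = x)].

(* The class of a loop is central iff it commutes, up to homotopy relative to
   the base point, with every loop. *)
Definition pi1_trivial_centre (R : realType) (T : topologicalType) (x : T) :=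
  forall a : R -> T, is_loop x a ->
    (forall b : R -> T, is_loop x b ->
       loop_homotopic x (loop_mul a b) (loop_mul b a)) ->
    loop_homotopic x a (cst x).

Definition std_simplex (R : realType) k : set 'rV[R]_k.+1 :=
  [set t | (forall i, 0 <= t 0 i) /\ \sum_i t 0 i = 1].

Definition face_map (R : realType) k (i : 'I_k.+2) (t : 'rV[R]_k.+1) :
    'rV[R]_k.+2 :=
  \row_j (if unlift i j is Some j' then t 0 j' else 0).

(* A singular simplex is represented by a function on the whole of R^(k+1), of
   which only the restriction to the standard simplex matters; a chain is a
   formal sum, i.e. a list of weighted simplices, of which only the
   coefficients (chain_coef) matter. *)
Definition chain (R : realType) (T : Type) k := seq (R * ('rV[R]_k.+1 -> T)).

Definition singular (R : realType) (T : topologicalType) k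
    (c : chain R T k) : Prop :=
  foldr (fun s P => {within @std_simplex R k, continuous s.2} /\ P) True c.

Definition chain_coef (R : realType) (T : Type) k (c : chain R T k)
    (s : 'rV[R]_k.+1 -> T) : R :=
  \sum_(w <- c) if `[< {in @std_simplex R k, w.2 =1 s} >] then w.1 else 0.

Definition boundary (R : realType) (T : Type) k (c : chain R T k.+1) :
    chain R T k :=
  [seq ((-1) ^+ val i * w.1, w.2 \o @face_map R k i) | w : R * ('rV[R]_k.+2 -> T) <- c,
     i : 'I_k.+2 <- enum 'I_k.+2].

Definition H1_nonzero (R : realType) (T : topologicalType) : Prop :=
  exists z : chain R T 1,
    [/\ singular z,
        (forall s, chain_coef (boundary z) s = 0) &
        (forall w : chain R T 2, singular w ->
           ~ (forall s, chain_coef (boundary w) s = chain_coef z s))].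

(* n-fold product measure; n.-tuple R carries the product (Borel)
   sigma-algebra. *)
Fixpoint lebesgue (R : realType) n : set (n.-tuple R) -> \bar R :=
  match n return set (n.-tuple R) -> \bar R with
  | 0 => \d_ [tuple]
  | n'.+1 => pushforward (@lebesgue_measure R \x @lebesgue R n')%E
               (fun p : R * n'.-tuple R => [tuple of p.1 :: p.2])
  end.

Definition rv (R : realType) n (x : n.-tuple R) : 'rV[R]_n :=
  \row_i tnth x i.

Definition cube (R : realType) n : set 'rV[R]_n :=
  [set x | forall i, 0 <= x 0 i <= 1].

Definition cube_boundary (R : realType) n : set 'rV[R]_n :=
  @cube R n `\` (@cube R n)^°.

(* Elements are represented by functions on R^n, of which only the restriction
   to the cube matters. *)
Definition SDiff (R : realType) n (f : 'rV[R]_n -> 'rV[R]_n) : Prop :=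
  [/\ (exists g : 'rV[R]_n -> 'rV[R]_n,
         [/\ set_bij (@cube R n) (@cube R n) f,
             {in @cube R n, cancel f g},
             {within @cube R n, continuous f},
             {within @cube R n, continuous g} &
             smooth_on (@cube R n)^° f /\ smooth_on (@cube R n)^° g]),
      f @` @cube_boundary R n = @cube_boundary R n,
      (forall x, (@cube R n)^° x -> 0 < \det ('J f x)) &
      (forall A : set (n.-tuple R), measurable A -> @rv R n @` A `<=` @cube R n ->
         lebesgue [set x | @cube R n (rv x) /\ (@rv R n @` A) (f (rv x))] =
         lebesgue A)].

(* The point (t, x) of [0, 1] x I^n is encoded as row_mx t%:M x. *)
Definition smooth_isotopy (R : realType) n
    (xi : R -> 'rV[R]_n -> 'rV[R]_n) : Prop :=
  [/\ (forall t, 0 <= t <= 1 -> SDiff (xi t)),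
      {in @cube R n, xi 0 =1 id} &
      smooth_on [set z : 'rV[R]_(1 + n) |
                  0 <= (lsubmx z : 'rV[R]_1) 0 0 <= 1 /\
                  (@cube R n)^° (rsubmx z)]
        (fun z : 'rV[R]_(1 + n) => xi ((lsubmx z : 'rV[R]_1) 0 0) (rsubmx z))].

(* Time derivative, one-sided at t = 0 and t = 1. *)
Definition velocity (R : realType) n (xi : R -> 'rV[R]_n -> 'rV[R]_n)
    (t : R) (x : 'rV[R]_n) : 'rV[R]_n :=
  lim ((s - t)^-1 *: (xi s x - xi t x) @[s --> within `[0, 1] t^']).

(* The space integral is over the interior of the cube, where the velocity is
   defined; the boundary is negligible. *)
Definition action (R : realType) n (xi : R -> 'rV[R]_n -> 'rV[R]_n) : \bar R :=
  ((2^-1)%:E * \int[@lebesgue_measure R]_(t in `[0%R, 1%R])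
     \int[@lebesgue R n]_(x in [set x | (@cube R n)^° (rv x)])
       ((enorm (velocity xi t (rv x))) ^+ 2)%:E)%E.

Definition supported_on (R : realType) n (xi : R -> 'rV[R]_n -> 'rV[R]_n)
    (K : set 'rV[R]_n) : Prop :=
  forall t x, 0 <= t <= 1 -> @cube R n x -> ~ K x -> xi t x = x.

Definition infinite_finite_pair (R : realType) n
    (xi eta : R -> 'rV[R]_n -> 'rV[R]_n) : Prop :=
  [/\ smooth_isotopy xi, smooth_isotopy eta, {in @cube R n, eta 1 =1 xi 1},
      action xi = +oo%E & (action eta < +oo)%E].

(* Main.v *)
Require Import Defs.
From HB Require Import structures.
From mathcomp Require Import all_boot all_order all_algebra.
From mathcomp Require Import all_classical all_reals all_analysis.
From mathcomp Require Import measurable_realfun ring lra.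
Import Order.TTheory GRing.Theory Num.Theory.
Import numFieldNormedType.Exports.
Local Open Scope classical_set_scope.
Local Open Scope ring_scope.
Set Implicit Arguments.
Unset Strict Implicit.
Unset Printing Implicit Defensive.

(** The conclusion only asks for one isotopy of infinite action and one isotopy
    of finite action with the same end map, so both can be written down.

    In each of the given balls, inside the tube, choose a small round ball with
    centre c_j and radius r_j, and turn every point x of it about c_j, in the
    plane of the first two coordinates, by the angle
    K_j t (1 - t) f(s) + E_j t g(s), where s is the squared relative distance
    from x to c_j, and f and g are bump functions with supports in [0, 1/2] and
    [1/2, 3/4]. The angle is invariant under the rotations about c_j, so these
    twists form a commuting flow; in particular they are invertible, and they
    preserve Lebesgue measure. The first term vanishes at both ends of [0, 1],
    so the end map does not depend on K: the isotopy with K = 0 has the same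
    end map. With K_j large the inner part of the j-th ball alone carries a
    kinetic energy of at least j for all t in [0, 1/4], and the action is
    infinite; with K = 0 and E_j at most 1 / (1 + r_j) all speeds are at most
    1, and the action is finite. In the outer shell the angle E_j t g(s)
    increases with t and is at most 1 radian, so that the motion neither stops
    nor returns (twisting_balls).

    The remaining work is to justify this picture.
    - Smoothness: all maps involved belong to a class of elementary functions
      that is closed under partial derivatives (elementary_derive). It contains
      the flat function exp(-1/x) (smooth1_flat).
    - Measure: a rotation is a product of three shears, which preserve the
      measure by Fubini (preserving_linear); a twist is a limit of maps that are
      piecewise rotations, which gives an inequality for open sets, and the
      inverse twist gives the converse inequality (twist_preserving).
    - Orientation: the jacobian determinant of a twist is the square of that of
      the twist by half the angle (twist_det_gt0).
    - All balls at once: they are locally finite inside the cube, which gives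
      smoothness (twists_smooth), and their radii tend to 0, which gives
      continuity up to the boundary (twists_continuous).
    - The tube contains a round ball: a point y close to the image of an
      interior point of M has a nearest point in the compact image, and the
      segment from this nearest point to y is normal to the image there
      (tube_contains_eball). *)

(** * Smooth functions of one variable *)

Section SmoothOneVariable.
Context {R : realType}.

(** A tower of successive derivatives; unlike an iterated derive operator, it
    can be exhibited by a closed formula. *)
Definition smooth1 (f : R -> R) : Prop :=
  exists2 F : nat -> R -> R, F 0%N = f &
    forall k x, is_derive x (1 : R) (F k) (F k.+1 x).

(** For a polynomial p this is p(1/x) exp(-1/x), extended by 0 to x <= 0; the
    family is closed under derivation, and p = 1 is the function from which the
    bump functions are made. *)
Definition flat (p : {poly R}) (x : R) : R :=
  if 0 < x then p.[x^-1] * expR (- x^-1) else 0.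

(** From 1 + y / k <= exp (y / k) one gets y^k exp(-y) <= k^k; sum over the
    coefficients of p. *)
Lemma horner_expRN_bounded (p : {poly R}) :
  exists2 C : R, 0 <= C & forall y, 0 <= y -> `|p.[y]| * expR (- y) <= C.
Proof.
have key k (y : R) : 0 <= y -> y ^+ k * expR (- y) <= k%:R ^+ k.
  move=> y0; rewrite expRN ler_pdivrMr ?expR_gt0//.
  case: k => [|k]; first by rewrite !expr0 mul1r -expR0 ler_expR.
  have k0 : 0 < k.+1%:R :> R by rewrite ltr0n.
  have -> : expR y = expR (y / k.+1%:R) ^+ k.+1.
    by rewrite -expRM_natl mulrCA divff ?mulr1// gt_eqF.
  rewrite -exprMn lerXn2r ?nnegrE ?mulr_ge0 ?expR_ge0//.
  rewrite -ler_pdivrMl// mulrC; apply: le_trans (expR_ge1Dx _).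
  by rewrite lerDr.
exists (\sum_(i < size p) `|p`_i| * i%:R ^+ i).
  by apply: sumr_ge0 => i _; rewrite mulr_ge0// exprn_ge0.
move=> y y0; rewrite horner_coef.
apply: (@le_trans _ _ ((\sum_(i < size p) `|p`_i * y ^+ i|) * expR (- y))).
  by rewrite ler_wpM2r ?expR_ge0// ler_norm_sum.
rewrite mulr_suml; apply: ler_sum => i _.
by rewrite normrM -mulrA ler_wpM2l// normrX (ger0_norm y0) key.
Qed.

(** This is the previous bound for p X^2, read at y = 1/x. *)
Lemma flat_quadratic (p : {poly R}) :
  exists2 C : R, 0 <= C & forall x, `|flat p x| <= C * x ^+ 2.
Proof.
have [C C0 HC] := horner_expRN_bounded (p * 'X^2); exists C => // x.
rewrite /flat; case: ifPn => [x0|_]; last by rewrite normr0 mulr_ge0// sqr_ge0.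
have := HC x^-1; rewrite invr_ge0 => /(_ (ltW x0)).
rewrite hornerM hornerXn normrM (ger0_norm (_ : 0 <= x^-1 ^+ 2)) ?sqr_ge0//.
rewrite exprVn mulrAC ler_pdivrMr ?exprn_gt0//.
by rewrite normrM (ger0_norm (expR_ge0 _)).
Qed.

(** Away from 0, the factor X^2 comes from the derivative - 1/x^2 of 1/x; at 0
    the quadratic bound forces the derivative 0. *)
Lemma is_derive_flat (p : {poly R}) x :
  is_derive x (1 : R) (flat p) (flat ('X^2 * (p - p^`())) x).
Proof.
have [x0|x0|->] := ltgtP x 0.
- rewrite {2}/flat ltNge (ltW x0)/=.
  apply: (@near_eq_is_derive _ _ _ (cst 0)).
  near=> y; rewrite /flat ltNge (_ : y <= 0)//=.
  by apply: ltW; near: y; exact: lt_nbhsl.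
- rewrite {2}/flat x0.
  have dV : is_derive x (1 : R) (fun y : R => y^-1) (- x ^- 2).
    apply: DeriveDef; first by apply: derivableV; rewrite ?gt_eqF.
    rewrite (_ : (fun y : R => y^-1) = (@GRing.inv R) \o id)//.
    by rewrite deriveV ?gt_eqF// derive_id /= [_ *: _]mulr1.
  have d1 : is_derive x (1 : R) (horner p \o (fun y => y^-1))
      (p^`().[x^-1] * - x ^- 2).
    exact: is_derive1_comp.
  have d2 : is_derive x (1 : R) (expR \o (fun y => - y^-1))
      (expR (- x^-1) * - - x ^- 2).
    by apply: is_derive1_comp; exact: is_deriveN.
  apply: (near_eq_is_derive _ (is_derive_eq (is_deriveM d1 d2) _)).
    near=> y; rewrite /flat (_ : 0 < y)//.
    by near: y; exact: lt_nbhsr.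
  rewrite /= /GRing.scale/= !hornerE opprK -exprVn.
  rewrite -[LHS]/(p.[x^-1] * expR (- x^-1) * x^-1 ^+ 2
    + expR (- x^-1) * p^`().[x^-1] * - x^-1 ^+ 2); ring.
- have -> : flat ('X^2 * (p - p^`())) 0 = 0 by rewrite /flat ltxx.
  have [C C0 HC] := flat_quadratic p.
  suff H : (fun h => h^-1 *: ((flat p \o shift 0) (h *: 1) - flat p 0))
      @ 0^' --> (0 : R).
    apply: DeriveDef; first by apply/cvg_ex; exists 0.
    exact/cvg_lim.
  apply/cvgr0Pnorm_le => e e0; near=> h.
  rewrite /= {2}/flat ltxx subr0 addr0 [h *: 1]mulr1 [_ *: _]mulrC.
  have h0 : h != 0 by near: h; exact: nbhs_dnbhs_neq.
  rewrite normrM normfV ler_pdivrMr ?normr_gt0//.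
  apply: (le_trans (HC _)); rewrite -real_normK ?num_real// expr2 mulrA.
  rewrite ler_wpM2r//.
  have : `|h| <= e / (C + 1).
    by near: h; apply: dnbhs0_le; rewrite divr_gt0// ltr_wpDl.
  rewrite ler_pdivlMr ?ltr_wpDl// mulrDr mulr1 mulrC; apply: le_trans.
  by rewrite lerDl.
Unshelve. all: by end_near. Qed.

Lemma smooth1_flat (p : {poly R}) : smooth1 (flat p).
Proof.
exists (fun k => flat (iter k (fun q => 'X^2 * (q - q^`())) p)) => // k x.
exact: is_derive_flat.
Qed.

Lemma smooth1_trig (a b : R) : smooth1 (fun x => a * cos x + b * sin x).
Proof.
pose c k := iter k (fun u : R * R => (u.2, - u.1)) (a, b).
exists (fun k x => (c k).1 * cos x + (c k).2 * sin x) => // k x.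
apply: (is_derive_eq (is_deriveD (is_deriveZ (c k).1 (is_derive_cos x))
  (is_deriveZ (c k).2 (is_derive_sin x)))).
by rewrite /= /GRing.scale/= mulrN mulNr addrC.
Qed.

Lemma smooth1_cos : smooth1 cos.
Proof.
by have := smooth1_trig 1 0; congr smooth1; apply/funext => x; ring.
Qed.

Lemma smooth1_sin : smooth1 sin.
Proof.
by have := smooth1_trig 0 1; congr smooth1; apply/funext => x; ring.
Qed.

Lemma smooth1_derive (f : R -> R) : smooth1 f ->
  exists2 f', smooth1 f' & forall x, is_derive x (1 : R) f (f' x).
Proof.
move=> [F <- dF]; exists (F 1%N) => //; exists (fun k => F k.+1) => // k x.
Qed.

Lemma smooth1_differentiable (f : R -> R) x : smooth1 f -> differentiable f x.
Proof.
by move=> /smooth1_derive[f' _ df]; apply/derivable1_diffP; have [] := df x.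
Qed.

Lemma smooth1_continuous (f : R -> R) : smooth1 f -> continuous f.
Proof.
by move=> sf x; apply: differentiable_continuous; exact: smooth1_differentiable.
Qed.

End SmoothOneVariable.

(** * Elementary functions *)

Section Elementary.
Context {R : realType}.

(** This class is closed under partial derivatives, which makes the C^k
    property of its members an induction on k alone. *)
Inductive elementary m : ('rV[R]_m -> R) -> Prop :=
| elementary_cst (c : R) : elementary (fun=> c)
| elementary_coord (i : 'I_m) : elementary (fun x => x 0 i)
| elementaryD f g : elementary f -> elementary g ->
    elementary (fun x => f x + g x)
| elementaryM f g : elementary f -> elementary g ->
    elementary (fun x => f x * g x)
| elementary_comp (phi : R -> R) f : smooth1 phi -> elementary f ->
    elementary (fun x => phi (f x)).

Lemma elementaryN m (f : 'rV[R]_m -> R) :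
  elementary f -> elementary (fun x => - f x).
Proof.
move=> ef; have := elementaryM (elementary_cst _ (-1)) ef.
by congr elementary; apply/funext => x; rewrite mulN1r.
Qed.

Lemma elementaryB m (f g : 'rV[R]_m -> R) :
  elementary f -> elementary g -> elementary (fun x => f x - g x).
Proof. by move=> ef eg; apply: elementaryD => //; exact: elementaryN. Qed.

Lemma elementary_sum m I (r : seq I) (f : I -> 'rV[R]_m -> R) :
  (forall i, elementary (f i)) -> elementary (fun x => \sum_(i <- r) f i x).
Proof.
move=> ef; elim: r => [|i r IH].
  have := elementary_cst m 0; congr elementary.
  by apply/funext => x; rewrite big_nil.
have := elementaryD (ef i) IH; congr elementary.
by apply/funext => x; rewrite big_cons.
Qed.

Lemma elementary_subst m p (f : 'rV[R]_m -> R) (G : 'rV[R]_p -> 'rV[R]_m) :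
  elementary f -> (forall i, elementary (fun z => G z 0 i)) ->
  elementary (fun z => f (G z)).
Proof.
move=> ef eG; elim: ef => /=.
- by move=> c; exact: elementary_cst.
- by move=> i; exact: eG.
- by move=> f1 f2 _ e1 _ e2; exact: (elementaryD e1 e2).
- by move=> f1 f2 _ e1 _ e2; exact: (elementaryM e1 e2).
- by move=> phi f1 sphi _ e1; exact: (elementary_comp sphi e1).
Qed.

Lemma elementary_differentiable m (f : 'rV[R]_m -> R) x :
  elementary f -> differentiable f x.
Proof.
elim=> /=.
- by move=> c; exact: differentiable_cst.
- by move=> i; exact: (@differentiable_coord _ 1 m x 0 i).
- by move=> f1 f2 _ e1 _ e2; exact: differentiableD.
- by move=> f1 f2 _ e1 _ e2; exact: differentiableM.
- move=> phi f1 sphi _ e1; apply: (@differentiable_comp _ _ _ _ f1 phi) => //.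
  exact: smooth1_differentiable.
Qed.

Lemma elementary_continuous m (f : 'rV[R]_m -> R) :
  elementary f -> continuous f.
Proof.
by move=> ef x; apply: differentiable_continuous; exact: elementary_differentiable.
Qed.

Lemma elementary_derive m (f : 'rV[R]_m -> R) v : elementary f ->
  exists2 f', elementary f' & forall x, is_derive x v f (f' x).
Proof.
elim=> /=.
- move=> c; exists (fun=> 0); first exact: elementary_cst.
  by move=> x; exact: is_derive_cst.
- move=> i; exists (fun=> v 0 i); first exact: elementary_cst.
  move=> x; have dx := @differentiable_coord _ 1 m x 0 i.
  apply: DeriveDef; first exact: diff_derivable.
  rewrite deriveE//.
  have lin : linear (fun N : 'rV[R]_m => N 0 i) by move=> a A B; rewrite !mxE.
  pose g := GRing.isLinear.Build _ _ _ _ _ lin.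
  pose gL : {linear 'rV[R]_m -> R} := HB.pack (fun N : 'rV[R]_m => N 0 i) g.
  rewrite [LHS](_ : _ = 'd gL x v)// diff_lin//.
  exact: coord_continuous.
- move=> f1 f2 _ [d1 e1 h1] _ [d2 e2 h2].
  by exists (fun x => d1 x + d2 x) => [|x]; [exact: elementaryD|exact: is_deriveD].
- move=> f1 f2 ef1 [d1 e1 h1] ef2 [d2 e2 h2].
  exists (fun x => f1 x * d2 x + f2 x * d1 x).
    by apply: elementaryD; exact: elementaryM.
  by move=> x; exact: is_deriveM.
- move=> phi f1 sphi ef1 [d1 e1 h1].
  have [phi' sphi' dphi] := smooth1_derive sphi.
  exists (fun x => phi' (f1 x) * d1 x).
    by apply: elementaryM => //; exact: elementary_comp.
  move=> x; have df1 := elementary_differentiable x ef1.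
  have dp := smooth1_differentiable (f1 x) sphi.
  have dc : differentiable (phi \o f1) x by exact: differentiable_comp.
  apply: DeriveDef; first exact: diff_derivable.
  rewrite deriveE// (diff_comp df1 dp)/=.
  rewrite -(deriveE _ df1); have [_ ->] := h1 x.
  rewrite diff1E// derive1E; have [_ ->] := dphi (f1 x).
  by rewrite /GRing.scale/= mulrC.
Qed.

Lemma cvg_rowP m (T : Type) (F : set_system T) {FF : Filter F}
    (f : T -> 'rV[R]_m) (l : 'rV[R]_m) :
  (forall i, f x 0 i @[x --> F] --> l 0 i) -> f x @[x --> F] --> l.
Proof.
move=> fl; apply/cvgrPdist_le => /= e e0.
near=> x.
rewrite /Num.Def.normr/= mx_normrE (bigmax_le _ (ltW e0))//= => -[i0 i] _.
rewrite !mxE/= (ord1 i0).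
move: i; near: x; apply: filter_forall => /= i.
exact: ((cvgrPdist_le _ _).1 (fl i)).
Unshelve. all: by end_near. Qed.

Lemma elementary_row_continuous m p (f : 'rV[R]_m -> 'rV[R]_p) :
  (forall i, elementary (fun x => f x 0 i)) -> continuous f.
Proof.
by move=> ef x; apply: (@cvg_rowP _ _ (nbhs x)) => i; exact: (elementary_continuous (ef i)).
Qed.

Lemma elementary_row_Ck m p k (U : set 'rV[R]_m) (f : 'rV[R]_m -> 'rV[R]_p) :
  (forall i, elementary (fun x => f x 0 i)) -> Ck k U f.
Proof.
elim: k f => [|k IH] f ef /=; split=> //.
- by move=> x _; exact: elementary_row_continuous.
- by move=> x _; exact: elementary_row_continuous.
move=> i.
have df x : derivable f x (delta_mx 0 i).
  apply/derivable_mxP => i0 j; rewrite (ord1 i0).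
  by have [f' _ /(_ x)[]] := elementary_derive (delta_mx 0 i) (ef j).
split=> [x _ //|]; apply: IH => j.
have [f' ef' dfj] := elementary_derive (delta_mx 0 i) (ef j).
rewrite (_ : (fun x => _) = f')//.
by apply/funext => x; rewrite derive_mx// mxE; have [] := dfj x.
Qed.

Lemma elementary_row_differentiable m p (f : 'rV[R]_m -> 'rV[R]_p) x :
  (forall i, elementary (fun x => f x 0 i)) -> differentiable f x.
Proof.
move=> ef.
rewrite (_ : f = \sum_(i < p) (fun y => f y 0 i *: delta_mx 0 i)).
  apply: differentiable_sum => i.
  by apply: differentiableZl; exact: elementary_differentiable.
by apply/funext => y; rewrite fct_sumE [LHS]row_sum_delta.
Qed.

End Elementary.

(** * Lebesgue measure on tuples *)

Section LebesgueMeasure.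
Context {R : realType}.

Definition tcons n (p : R * n.-tuple R) : n.+1.-tuple R := [tuple of p.1 :: p.2].

Lemma measurable_tcons n :
  measurable_fun [set: (measurableTypeR R * n.-tuple R)%type] (@tcons n).
Proof. by apply: measurable_cons. Qed.

Definition tdrop n (t : n.+1.-tuple R) : n.-tuple R := [tuple of behead t].

Lemma thead_tcons n x (r : n.-tuple R) : thead (tcons (x, r)) = x.
Proof. exact: theadE. Qed.

Lemma tdrop_tcons n x (r : n.-tuple R) : tdrop (tcons (x, r)) = r.
Proof. exact: val_inj. Qed.

Lemma tcons_eta n (t : n.+1.-tuple R) : t = tcons (thead t, tdrop t).
Proof. exact: tuple_eta. Qed.

Lemma measurable_thead n :
  measurable_fun [set: n.+1.-tuple R] (fun t => thead t).
Proof. exact: (measurable_tnth ord0). Qed.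

Lemma measurable_tdrop n : measurable_fun [set: n.+1.-tuple R] (@tdrop n).
Proof. exact: measurable_behead. Qed.

Lemma measurable_mk n d (T : measurableType d) (f : T -> R)
    (g : T -> n.-tuple R) :
  measurable_fun setT f -> measurable_fun setT g ->
  measurable_fun setT (fun t => tcons (f t, g t)).
Proof. exact: measurable_cons. Qed.

Lemma tnth_tdrop n (t : n.+1.-tuple R) i : tnth (tdrop t) i = tnth t (lift ord0 i).
Proof. by rewrite [in RHS](tcons_eta t) tnthS. Qed.

Lemma lebesgueS n (A : set (n.+1.-tuple R)) :
  lebesgue A =
  (\int[@lebesgue_measure R]_x lebesgue [set r | A (tcons (x, r))])%E.
Proof.
apply: eq_integral => x _ /=; congr (lebesgue _).
by apply/seteqP; split=> r; rewrite /xsection /= inE.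
Qed.

Lemma lebesgue_sigma_finite n :
  exists m : {sigma_finite_measure set (n.-tuple R) -> \bar R},
    m = @lebesgue R n :> (set (n.-tuple R) -> \bar R).
Proof.
elim: n => [|n [m mE]].
  by exists (@dirac _ (0.-tuple R) [tuple] R).
have mc := @measurable_tcons n.
pose P := (@lebesgue_measure R \x m)%E.
have [m' m'E] : exists m' : {measure set (n.+1.-tuple R) -> \bar R},
   m' = @lebesgue R n.+1 :> (set (n.+1.-tuple R) -> \bar R).
  exists (@measure_function_pushforward__canonical__measure_function_Measure
    _ _ _ _ R P _ mc).
  by apply/funext => A; rewrite /= -mE.
have sf : sigma_finite setT m'.
  have mth : measurable_fun [set: n.+1.-tuple R] (fun t => thead t).
    exact: (measurable_tnth ord0).
  have mbh := @measurable_tdrop n.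
  have /sigma_finiteP[F [FT ndF mF]] := sigma_finiteT (@lebesgue_measure R).
  have /sigma_finiteP[G [GT ndG mG]] := sigma_finiteT m.
  exists (fun i => [set t : n.+1.-tuple R |
    F i (thead t) /\ G i (tdrop t)]).
    apply/seteqP; split=> // t _.
    have [i _ Fi] : (\bigcup_i F i) (thead t) by rewrite -FT.
    have [j _ Gj] : (\bigcup_i G i) (tdrop t) by rewrite -GT.
    exists (maxn i j) => //; split.
    - by move: Fi; apply/subsetPset/ndF/leq_maxl.
    - by move: Gj; apply/subsetPset/ndG/leq_maxr.
  move=> i; have [mFi Fi] := mF i; have [mGi Gi] := mG i; split.
    by apply: measurableI;
      [move: (mth measurableT _ mFi)|move: (mbh measurableT _ mGi)];
      rewrite setTI.
  rewrite m'E /= /pushforward -mE.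
  rewrite [X in product_measure1 _ _ X](_ : _ = F i `*` G i).
    by rewrite product_measure1E// lte_mul_pinfty// ge0_fin_numE.
  by apply/seteqP; split=> -[x r] /=; rewrite thead_tcons tdrop_tcons.
pose H1 := @isSFinite.Build _ _ _ m' (sfinite_measure_sigma_finite sf).
pose H2 := @isSigmaFinite.Build _ _ _ m' sf.
pose M : {sigma_finite_measure set (n.+1.-tuple R) -> \bar R} :=
  HB.pack_for (SigmaFiniteMeasure.type (n.+1.-tuple R) R)
    (Measure.sort m') H1 H2.
by exists M.
Qed.

(** The set function lebesgue, bundled as a sigma-finite measure. *)
Definition lebm n := sval (cid (lebesgue_sigma_finite n)).

Lemma lebmE n : lebm n = @lebesgue R n :> (set (n.-tuple R) -> \bar R).
Proof. exact: (svalP (cid (lebesgue_sigma_finite n))). Qed.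

Lemma lebesgue_box n (a b : 'I_n -> R) : (forall i, a i <= b i) ->
  measurable [set t : n.-tuple R | forall i, a i < tnth t i < b i] /\
  lebesgue [set t : n.-tuple R | forall i, a i < tnth t i < b i] =
  (\prod_i (b i - a i))%:E.
Proof.
elim: n a b => [|n IH] a b ab.
  rewrite big_ord0 (_ : mkset _ = setT); last by apply/seteqP; split=> t _ // [].
  by split; [exact: measurableT|rewrite /= diracT].
have [mB lB] := IH (fun i => a (lift ord0 i)) (fun i => b (lift ord0 i))
  (fun i => ab (lift ord0 i)).
set B := (mkset _) in mB lB; set A := mkset _.
have AE : A = (fun t => thead t) @^-1` `]a ord0, b ord0[ `&`
    (fun t => tdrop t) @^-1` B.
  apply/seteqP; split=> t.
    by move=> At; split=> [|i] /=; rewrite ?in_itv/= ?tnth_tdrop; exact: At.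
  move=> [/=]; rewrite in_itv/= => h1 h2 i.
  case: (unliftP ord0 i) => [j ->|-> //].
  by have := h2 j; rewrite tnth_tdrop.
have mA : measurable A.
  rewrite AE; apply: measurableI.
    rewrite -[X in measurable X]setTI.
    by apply: (@measurable_thead n) => //; exact: measurable_itv.
  by have := @measurable_tdrop n measurableT _ mB; rewrite setTI.
split=> //=; rewrite /pushforward -lebmE.
rewrite [X in product_measure1 _ _ X](_ : _ = `]a ord0, b ord0[ `*` B).
  rewrite product_measure1E//= lebmE lB lebesgue_measure_itv/= big_ord_recl EFinM.
  rewrite lte_fin; case: ltP => // ba.
  by rewrite (_ : b ord0 = a ord0) ?subrr//; apply/le_anti; rewrite ba ab.
by apply/seteqP; split=> -[x r] /=; rewrite AE /= thead_tcons tdrop_tcons.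
Qed.

End LebesgueMeasure.

(** * Measure preserving maps: shears and rotations *)

Section Preserving.
Context {R : realType}.

Definition preserving n (f : n.-tuple R -> n.-tuple R) : Prop :=
  measurable_fun [set: n.-tuple R] f /\
  forall A : set (n.-tuple R), measurable A ->
    lebesgue (f @^-1` A) = lebesgue A.

Lemma preserving_comp n (f g : n.-tuple R -> n.-tuple R) :
  preserving f -> preserving g -> preserving (f \o g).
Proof.
move=> [mf pf] [mg pg]; split; first exact: measurableT_comp.
move=> A mA; rewrite comp_preimage pg; first exact: pf.
by rewrite -[X in measurable X]setTI; exact: mf.
Qed.

Lemma preserving_id n : preserving (@id (n.-tuple R)).
Proof. by split=> //; exact: measurable_id. Qed.

Lemma eq_preserving n (f g : n.-tuple R -> n.-tuple R) :
  f =1 g -> preserving f -> preserving g.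
Proof. by move=> /funext ->. Qed.

Lemma measurable_section n (A : set (n.+1.-tuple R)) x :
  measurable A -> measurable [set r | A (tcons (x, r))].
Proof.
move=> mA; have := @measurable_mk R n _ _ (cst x) id (@measurable_cst _ _ _ _ _ _)
  (@measurable_id _ _ _).
by move=> /(_ measurableT _ mA); rewrite setTI.
Qed.

(** Fubini along the first coordinate. *)
Lemma preserving_fiberwise n (phi : R -> n.-tuple R -> n.-tuple R)
    (f : n.+1.-tuple R -> n.+1.-tuple R) :
  measurable_fun setT f ->
  (forall x r, f (tcons (x, r)) = tcons (x, phi x r)) ->
  (forall x, preserving (phi x)) -> preserving f.
Proof.
move=> mf fE pphi; split=> // A mA.
rewrite !lebesgueS; apply: eq_integral => x _.
rewrite -((pphi x).2 _ (measurable_section x mA)).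
by congr lebesgue; apply/seteqP; split=> r /=; rewrite fE.
Qed.

Lemma lebesgue_measure_translation (a : R) (A : set R) : measurable A ->
  pushforward lebesgue_measure (fun x => x + a : measurableTypeR R) A =
  lebesgue_measure A.
Proof.
have ma : measurable_fun [set: measurableTypeR R]
  (fun x => x + a : measurableTypeR R) by exact: measurable_funD.
pose m := measure_function_pushforward__canonical__measure_function_Measure
  (@lebesgue_measure R) ma.
move=> mA; apply/esym; apply: (lebesgue_measure_unique (mu := m)) => //= _ [[u v]] _ <-.
rewrite /pushforward (_ : _ @^-1` _ = `]u - a, v - a]%classic).
  by rewrite !lebesgue_measure_itv/= !lte_fin ltrD2r -!EFinB opprD addrACA subrr addr0.
by apply/seteqP; split=> x /=; rewrite !in_itv/= ltrBlDr lerBrDr.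
Qed.

Definition ttranslate n (a : R) (t : n.+1.-tuple R) : n.+1.-tuple R :=
  tcons (thead t + a, tdrop t).

Lemma measurable_lebesgue_section n (A : set (n.+1.-tuple R)) : measurable A ->
  measurable_fun [set: measurableTypeR R]
    (fun x => lebesgue [set r | A (tcons (x, r))]).
Proof.
move=> mA; rewrite -lebmE.
have := measurable_fun_xsection (lebm n) (A := @tcons R n @^-1` A)
  (T1 := measurableTypeR R).
rewrite -[X in measurable X]setTI => /(_ (@measurable_tcons R n measurableT _ mA)).
congr measurable_fun; apply/funext => x /=; congr (lebm n _).
by apply/seteqP; split=> r; rewrite /xsection /= inE.
Qed.

Lemma preserving_translate n a : preserving (@ttranslate n a).
Proof.
split.
  apply: measurable_mk; last exact: measurable_tdrop.
  by apply: measurable_funD => //; exact: measurable_thead.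
move=> A mA; rewrite !lebesgueS.
pose tr (x : measurableTypeR R) : measurableTypeR R := x + a.
have ma : measurable_fun setT tr by exact: measurable_funD.
transitivity (\int[pushforward lebesgue_measure tr]_x lebesgue [set r | A (tcons (x, r))])%E.
  rewrite ge0_integral_pushforward//=.
  - apply: eq_integral => x _ /=; congr lebesgue.
    by apply/seteqP; split=> r /=; rewrite /ttranslate thead_tcons tdrop_tcons.
  - exact: measurable_lebesgue_section.
  - by move=> x _; rewrite -lebmE measure_ge0.
apply: eq_measure_integral => B mB _.
exact: lebesgue_measure_translation.
Qed.

Definition tswap n (t : n.+2.-tuple R) : n.+2.-tuple R :=
  tcons (thead (tdrop t), tcons (thead t, tdrop (tdrop t))).

Lemma measurable_tswap n : measurable_fun setT (@tswap n).
Proof.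
apply: measurable_mk.
  by apply: measurableT_comp; [exact: measurable_thead|exact: measurable_tdrop].
apply: measurable_mk; first exact: measurable_thead.
by apply: measurableT_comp; exact: measurable_tdrop.
Qed.

(** Exchange of the order of integration in the first two variables. *)
Lemma preserving_swap n : preserving (@tswap n).
Proof.
split; first exact: measurable_tswap.
move=> A mA; rewrite !lebesgueS.
pose f (z : measurableTypeR R * measurableTypeR R) :=
  lebesgue [set r | A (tcons (z.1, tcons (z.2, r)))].
have mf : measurable_fun setT f.
  rewrite /f -lebmE.
  pose g (p : measurableTypeR R * measurableTypeR R * n.-tuple R) :=
    tcons (p.1.1, tcons (p.1.2, p.2)).
  have mg : measurable_fun setT g.
    apply: measurable_mk; first by apply: measurableT_comp.
    by apply: measurable_mk; first by apply: measurableT_comp.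
  have := measurable_fun_xsection (lebm n) (A := g @^-1` A).
  rewrite -[X in measurable X]setTI => /(_ (mg measurableT _ mA)).
  congr measurable_fun; apply/funext => x /=; congr (lebm n _).
  by apply/seteqP; split=> r; rewrite /xsection /g /= inE.
have f0 z : (0 <= f z)%E by rewrite /f -lebmE measure_ge0.
have E := fubini_tonelli (m1 := @lebesgue_measure R) (m2 := @lebesgue_measure R) f mf f0.
rewrite /f /= in E.
transitivity (\int[@lebesgue_measure R]_y \int[@lebesgue_measure R]_x
   lebesgue [set r | A (tcons (x, tcons (y, r)))])%E; last first.
  rewrite -E; apply: eq_integral => x _; exact/esym/lebesgueS.
apply: eq_integral => y _; rewrite lebesgueS; apply: eq_integral => x _.
by congr lebesgue; apply/seteqP; split=> r /=;
  rewrite /tswap ?(thead_tcons, tdrop_tcons).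
Qed.

Definition tshear n (s : R) (t : n.+2.-tuple R) : n.+2.-tuple R :=
  tcons (thead t, ttranslate (s * thead t) (tdrop t)).

Lemma preserving_shear n s : preserving (@tshear n s).
Proof.
apply: (@preserving_fiberwise _ (fun x => ttranslate (s * x))) => [|x r|x].
- apply: measurable_mk; first exact: measurable_thead.
  apply: measurable_mk.
    apply: measurable_funD.
      by apply: measurableT_comp; [exact: measurable_thead|exact: measurable_tdrop].
    by apply: measurable_funM => //; exact: measurable_thead.
  by apply: measurableT_comp; exact: measurable_tdrop.
- by rewrite /tshear thead_tcons tdrop_tcons.
- exact: preserving_translate.
Qed.

Definition tlinear n (p q : R) (t : n.+2.-tuple R) : n.+2.-tuple R :=
  let x := thead t in let y := thead (tdrop t) in
  tcons (p * x - q * y, tcons (q * x + p * y, tdrop (tdrop t))).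

(** A rotation of angle other than pi is a product of three shears with
    coefficients - tan(angle / 2), sin(angle), - tan(angle / 2); the half turn is
    the square of a quarter turn. *)
Lemma preserving_linear n p q : p ^+ 2 + q ^+ 2 = 1 -> preserving (@tlinear n p q).
Proof.
have shears (a b : R) : a != -1 -> a ^+ 2 + b ^+ 2 = 1 -> preserving (@tlinear n a b).
  move=> a1 ab; have a10 : 1 + a != 0 by rewrite addrC -subr_eq0 opprK in a1 *.
  pose s := - (b / (1 + a)).
  apply: (@eq_preserving _ ((@tswap n \o tshear s \o @tswap n) \o tshear b \o
    (@tswap n \o tshear s \o @tswap n))).
    move=> t; rewrite (tcons_eta t) (tcons_eta (tdrop t)).
    rewrite /= /tswap /tshear /ttranslate /tlinear.
    rewrite !(thead_tcons, tdrop_tcons).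
    have sE : b * s = a - 1.
      rewrite /s mulrN mulrA -expr2; apply/eqP; rewrite -subr_eq0 opprB.
      have -> : b ^+ 2 = 1 - a ^+ 2 by rewrite -ab addrAC subrr add0r.
      by apply/eqP; field.
    have sb : s * (1 + a) = - b by rewrite /s; field.
    set x := thead t; set y := thead (tdrop t).
    have E2 : y + b * (x + s * y) = b * x + a * y.
      by rewrite mulrDr mulrA sE; ring.
    have E1 : x + s * y + s * (b * x + a * y) = a * x - b * y.
      transitivity (x + (b * s) * x + s * (1 + a) * y); first by ring.
      by rewrite sE sb; ring.
    by rewrite E2 E1.
  have sw := @preserving_swap n.
  have ss := preserving_comp (preserving_comp sw (@preserving_shear n s)) sw.
  exact: (preserving_comp (preserving_comp ss (@preserving_shear n b)) ss).
move=> pq; have [pN1|] := eqVneq p (-1); last by move=> /shears; apply.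
apply: (@eq_preserving _ (tlinear 0 1 \o tlinear 0 1)).
  have q0 : q = 0.
    by apply/eqP; rewrite -sqrf_eq0 -(addKr (p ^+ 2) (q ^+ 2)) pq pN1 sqrrN expr1n addNr.
  move=> t; rewrite /= {1}/tlinear ![thead (tlinear _ _ _)]thead_tcons.
  rewrite ![tdrop (tlinear _ _ _)]tdrop_tcons thead_tcons tdrop_tcons.
  rewrite /tlinear pN1 q0; congr (tcons (_, tcons (_, _))); ring.
have N1 : 0 != -1 :> R by rewrite eq_sym oppr_eq0 oner_eq0.
by apply: preserving_comp; apply: shears => //; rewrite expr0n expr1n add0r.
Qed.

Lemma preserving_affine n p q c d : p ^+ 2 + q ^+ 2 = 1 ->
  preserving (fun t : n.+2.-tuple R =>
    let x := thead t in let y := thead (tdrop t) in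
    tcons (p * x - q * y + c, tcons (q * x + p * y + d, tdrop (tdrop t)))).
Proof.
move=> pq; pose T (t : n.+2.-tuple R) := tcons (thead t, ttranslate d (tdrop t)).
have pT : preserving T.
  apply: (@preserving_fiberwise _ (fun=> ttranslate d)) => [|x r|x].
  - apply: measurable_mk; first exact: measurable_thead.
    apply: measurableT_comp; last exact: measurable_tdrop.
    by have [] := preserving_translate n d.
  - by rewrite /T thead_tcons tdrop_tcons.
  - exact: preserving_translate.
apply: (@eq_preserving _ (ttranslate c \o T \o tlinear p q)).
  by move=> t; rewrite /= /T /ttranslate /tlinear !(thead_tcons, tdrop_tcons).
apply: preserving_comp; last exact: preserving_linear.
exact: (preserving_comp (@preserving_translate _ c) pT).
Qed.

End Preserving.

(** * Measure preservation for twists *)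

Section TwistPreserving.
Context {R : realType}.

Definition tv n (v : 'rV[R]_n) : n.-tuple R := [tuple v 0 i | i < n].

Lemma rvK n : cancel (@rv R n) (@tv n).
Proof. by move=> t; apply: eq_from_tnth => i; rewrite tnth_mktuple mxE. Qed.

Lemma tvK n : cancel (@tv n) (@rv R n).
Proof. by move=> v; apply/rowP => i; rewrite mxE tnth_mktuple. Qed.

Lemma elementary_measurable n (f : 'rV[R]_n -> R) : elementary f ->
  measurable_fun [set: n.-tuple R] (fun t => f (rv t)).
Proof.
elim=> /=.
- by move=> c; exact: measurable_cst.
- move=> i; rewrite (_ : (fun t => _) = fun t : n.-tuple R => tnth t i).
    exact: measurable_tnth.
  by apply/funext => t; rewrite mxE.
- by move=> f1 f2 _ m1 _ m2; exact: measurable_funD.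
- by move=> f1 f2 _ m1 _ m2; exact: measurable_funM.
- move=> phi f1 sphi _ m1; apply: (@measurableT_comp _ _ _ _ _ _ phi) => //.
  exact: (continuous_measurable_fun (smooth1_continuous sphi)).
Qed.

Lemma elementary_row_measurable n (F : 'rV[R]_n -> 'rV[R]_n) :
  (forall i, elementary (fun v => F v 0 i)) ->
  measurable_fun [set: n.-tuple R] (fun t => tv (F (rv t))).
Proof.
move=> eF; apply/measurable_fun_tnthP => i.
rewrite (_ : _ \o _ = fun t => F (rv t) 0 i).
  exact: (elementary_measurable (eF i)).
by apply/funext => t /=; rewrite tnth_mktuple.
Qed.

(** The topology of row vectors, transported to the tuples on which the measure
    lives. *)
Definition topen n (A : set (n.-tuple R)) : Prop := open [set v | A (tv v)].

Lemma measurable_tuple_topen n : @measurable _ (n.-tuple R) =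
  <<s [set A | measurable A /\ topen A] >>.
Proof.
set G := (G in <<s G >>).
apply/seteqP; split; last first.
  apply: smallest_sub; first exact: sigma_algebra_measurable.
  by move=> A [].
suff : measurable_fun [set: g_sigma_algebraType G] (@id (n.-tuple R)).
  by move=> mid A /(mid measurableT); rewrite setTI.
apply/measurable_fun_tnthP => i.
apply: (measurability _ (RGenOpens.measurableE R)).
move=> _ [_ [x [y ->]] <-]; apply: sub_sigma_algebra; split.
  exact: (measurable_tnth i).
rewrite setTI /topen.
rewrite (_ : [set v | _] = (fun v : 'rV[R]_n => v 0 i) @^-1` `]x, y[).
  by apply: open_comp; [move=> v _; exact: coord_continuous|exact: interval_open].
by apply/seteqP; split=> v /=; rewrite tnth_mktuple.
Qed.

(** The pieces are countably many, so that countable additivity applies. This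
    serves twice: for rounded twists, and to put the balls together. *)
Lemma preserving_glue n (P : nat -> set (n.-tuple R))
    (F : nat -> n.-tuple R -> n.-tuple R) (f : n.-tuple R -> n.-tuple R) :
  (forall k, measurable (P k)) -> trivIset setT P -> \bigcup_k P k = setT ->
  (forall k, preserving (F k)) -> (forall k t, P k (F k t) <-> P k t) ->
  (forall k t, P k t -> f t = F k t) -> preserving f.
Proof.
move=> mP tP PT pF PF fF.
have fE A : f @^-1` A = \bigcup_k (F k @^-1` (P k `&` A)).
  apply/seteqP; split=> [t Aft|t [k _ [/PF Pk AF]]].
    have [k _ Pk] : (\bigcup_k P k) t by rewrite PT.
    by exists k => //; split; [exact/PF|rewrite -(fF k)].
  by rewrite /= (fF k).
have mFA k A : measurable A -> measurable (F k @^-1` (P k `&` A)).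
  move=> mA; rewrite -[X in measurable X]setTI; apply: (pF k).1 => //.
  exact: measurableI.
have mf : measurable_fun setT f.
  move=> _ A mA; rewrite setTI fE; apply: bigcupT_measurable => k.
  exact: mFA.
split=> // A mA; rewrite fE -lebmE measure_semi_bigcup; last 3 first.
- by move=> k; exact: mFA.
- move=> i j _ _ [t [[/PF Pi _] [/PF Pj _]]].
  by apply: tP => //; exists t.
- by apply: bigcupT_measurable => k; exact: mFA.
rewrite -[A in RHS]setTI -PT setI_bigcupl measure_semi_bigcup; last 3 first.
- by move=> k; exact: measurableI.
- by move=> i j _ _ [t [[Pi _] [Pj _]]]; apply: tP => //; exists t.
- by apply: bigcupT_measurable => k; exact: measurableI.
apply: eq_eseriesr => k _.
have := (pF k).2 _ (measurableI _ _ (mP k) mA); rewrite -lebmE; exact.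
Qed.

(** Here rho is a measure preserving flow; the twist by alpha moves t along the
    flow for the time alpha t. *)
Section Twist.
Variables (n : nat) (rho : R -> n.-tuple R -> n.-tuple R).
Hypothesis rho0 : forall t, rho 0 t = t.
Hypothesis rhoD : forall a b t, rho (a + b) t = rho a (rho b t).
Hypothesis rho_preserving : forall a, preserving (rho a).
Hypothesis rho_continuous : forall t, continuous (fun a => rv (rho a t)).

(** Rounding alpha to the multiples of 1 / m makes the twist a piecewise
    rotation, which preserves the measure; a point that the twist maps into an
    open set is mapped there by all the roundings that are fine enough. *)
Lemma twist_lebesgue_le (alpha : n.-tuple R -> R) (A : set (n.-tuple R)) :
  measurable_fun setT alpha -> (forall a t, alpha (rho a t) = alpha t) ->
  measurable ((fun t => rho (alpha t) t) @^-1` A) ->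
  measurable A -> topen A ->
  (lebesgue ((fun t => rho (alpha t) t) @^-1` A) <= lebesgue A)%E.
Proof.
move=> malpha alphaE mTA mA oA.
pose fl m t := Num.floor (m.+1%:R * alpha t).
pose T m t := rho ((fl m t)%:~R / m.+1%:R) t.
have pT m : preserving (T m).
  (* The pieces are indexed by integers; preserving_glue wants naturals. *)
  pose z k : int := odflt 0 (unpickle k).
  apply: (@preserving_glue _ (fun k => [set t | pickle (fl m t) = k])
    (fun k => rho ((z k)%:~R / m.+1%:R))) => //.
  - move=> k; rewrite (_ : mkset _ = if pickle (z k) == k then
      (fun t => m.+1%:R * alpha t) @^-1` `[(z k)%:~R, (z k + 1)%:~R[ else set0).
      case: ifP => // _; rewrite -[X in measurable X]setTI.
      by apply: measurable_funM => //; exact: measurable_itv.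
    apply/seteqP; split=> t /=.
      move=> <-; rewrite /z pickleK /= eqxx /= in_itv/=.
      by rewrite floor_le_tmp floorD1_gt.
    case: ifP => // /eqP zk; rewrite /= in_itv/= => /floor_def.
    by rewrite -/(fl m t) => ->.
  - by move=> i j _ _ [t /= [<- <-]].
  - by apply/seteqP; split=> // t _; exists (pickle (fl m t)).
  - by move=> k t /=; rewrite /fl alphaE.
  - by move=> k t /= <-; rewrite /T /z pickleK.
pose F N := \bigcap_(m in [set m | (N <= m)%N]) (T m @^-1` A).
have mF N : measurable (F N).
  apply: bigcap_measurable => [|m _]; first by exists N => /=.
  by rewrite -[X in measurable X]setTI; apply: (pT m).1.
have sub : (fun t => rho (alpha t) t) @^-1` A `<=` \bigcup_N F N.
  move=> t /= At.
  have cv : rv (T m t) @[m --> \oo] --> rv (rho (alpha t) t).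
    apply: (cvg_comp (fun m => (fl m t)%:~R / m.+1%:R)
      (fun a => rv (rho a t)) _ (@rho_continuous t (alpha t))).
    apply/cvgrPdist_le => e e0; near=> m.
    have m0 : 0 < m.+1%:R :> R by rewrite ltr0n.
    have -> : alpha t - (fl m t)%:~R / m.+1%:R =
      (m.+1%:R * alpha t - (fl m t)%:~R) / m.+1%:R by field; rewrite gt_eqF.
    rewrite normrM normfV (ger0_norm (ltW m0)) ler_pdivrMr//.
    apply: (@le_trans _ _ 1).
      rewrite ger0_norm ?subr_ge0 ?floor_le_tmp// lerBlDl ltW//.
      by have := floorD1_gt (m.+1%:R * alpha t); rewrite intrD.
    rewrite -ler_pdivrMl// mulr1.
    near: m; apply: filterS (nbhs_infty_ger e^-1) => m /le_trans; apply.
    by rewrite ler_nat.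
  have nA : nbhs (rv (rho (alpha t) t)) [set v | A (tv v)].
    by apply: open_nbhs_nbhs; split=> //=; rewrite rvK.
  have [N _ HN] := cv _ nA.
  by exists N => // m /= Nm; have := HN _ Nm; rewrite /= rvK.
have mbF : measurable (\bigcup_N F N) by exact: bigcupT_measurable.
rewrite -lebmE; apply: (@le_trans _ _ (lebm n (\bigcup_N F N))).
  by apply: le_measure; rewrite ?inE.
have ndF : {homo F : N M / (N <= M)%N >-> (N <= M)%O}.
  move=> N M NM; apply/subsetPset => t Ft m /= Mm.
  by apply: Ft => /=; exact: leq_trans NM Mm.
have cv := nondecreasing_cvg_mu (mu := lebm n) mF mbF ndF.
rewrite -(cvg_lim _ cv)//; apply: lime_le; first by apply/cvg_ex; eexists; exact: cv.
near=> N; rewrite /= lebmE -[leRHS](pT N).2// -lebmE.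
apply: le_measure; rewrite ?inE//; last by move=> t; apply => /=.
by rewrite -[X in measurable X]setTI; apply: (pT N).1.
Unshelve. all: by end_near. Qed.

(** Neither the twist nor its inverse increases the measure of an open set,
    and the open sets generate the measurable ones. *)
Lemma twist_preserving (alpha : n.-tuple R -> R) :
  measurable_fun setT alpha -> (forall a t, alpha (rho a t) = alpha t) ->
  measurable_fun setT (fun t => rho (alpha t) t) ->
  measurable_fun setT (fun t => rho (- alpha t) t) ->
  continuous (fun v => rv (rho (alpha (tv v)) (tv v))) ->
  preserving (fun t => rho (alpha t) t).
Proof.
move=> malpha alphaE mT mT' cT; split=> // A mA.
set T := fun t => rho (alpha t) t in mT *.
set T' := fun t => rho (- alpha t) t in mT' *.
have TK t : T (T' t) = t.
  by rewrite /T /T' alphaE -rhoD subrr rho0.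
have pre (f : n.-tuple R -> n.-tuple R) B : measurable_fun setT f ->
    measurable B -> measurable (f @^-1` B).
  by move=> mf mB; have := mf measurableT _ mB; rewrite setTI.
pose mu := measure_function_pushforward__canonical__measure_function_Measure
  (lebm n) mT.
rewrite -lebmE -[LHS]/(mu A).
pose g k : set (n.-tuple R) := [set t | forall i, `|tnth t i| < k%:R].
have gE k : g k = \big[setI/setT]_(i < n)
    ((fun t : n.-tuple R => tnth t i) @^-1` `]- k%:R, k%:R[).
  rewrite -bigcap_seq; apply/seteqP; split=> t /= gt i.
    by move=> _ /=; have := gt i; rewrite in_itv/= -ltr_norml.
  by have := gt i (mem_index_enum i); rewrite /= in_itv/= -ltr_norml.
have mg k : measurable (g k).
  rewrite gE; apply: bigsetI_measurable => i _.
  rewrite -[X in measurable X]setTI.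
  by apply: (measurable_tnth i) => //; exact: measurable_itv.
have og k : topen (g k).
  rewrite /topen openE => v gv.
  suff : \forall w \near v, forall i, `|tnth (tv w) i| < k%:R by [].
  pose f (i : 'I_n) : set 'rV[R]_n := [set w | `|tnth (tv w) i| < k%:R].
  apply: (@filter_forall _ _ f (nbhs v)) => i.
  have cont : continuous (fun w : 'rV[R]_n => `|tnth (tv w) i|).
    rewrite (_ : (fun w => _) = fun w : 'rV[R]_n => `|w 0 i|).
      by move=> w; apply: continuous_comp;
        [exact: coord_continuous|exact: norm_continuous].
    by apply/funext => w; rewrite tnth_mktuple.
  exact: (cont v _ (lt_nbhsl (gv i))).
have le B U : measurable U -> topen U -> B = T @^-1` U ->
    (lebesgue B <= lebesgue U)%E.
  move=> mU oU ->; exact: (@twist_lebesgue_le alpha U malpha alphaE (pre _ _ mT mU)).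
apply: (@measure_unique _ _ _ _ g (@measurable_tuple_topen n) _ _ _ mu (lebm n)) => //.
- move=> B C [mB oB] [mC oC]; split; first exact: measurableI.
  exact: openI.
- apply/seteqP; split=> // t _.
  pose k := Num.bound (\sum_i `|tnth t i|); exists k => // i.
  apply: (@le_lt_trans _ _ (\sum_i `|tnth t i|)).
    by rewrite (bigD1 i)//= lerDl sumr_ge0.
  by apply: le_lt_trans (archi_boundP _); rewrite ?ler_norm// sumr_ge0.
- move=> U [mU oU]; rewrite /= /pushforward lebmE; apply/eqP.
  rewrite eq_le le//=.
  have mTU : measurable (T @^-1` U) := pre _ _ mT mU.
  have oTU : topen (T @^-1` U).
    rewrite /topen (_ : mkset _ = (fun v => rv (rho (alpha (tv v)) (tv v)))
      @^-1` [set v | U (tv v)]).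
      by apply: open_comp => // v _; exact: cT.
    by apply/seteqP; split=> v /=; rewrite rvK.
  rewrite [X in (lebesgue X <= _)%E](_ : U = T' @^-1` (T @^-1` U)); last first.
    by apply/seteqP; split=> t /=; rewrite TK.
  have := @twist_lebesgue_le (fun t => - alpha t) (T @^-1` U).
  rewrite -/T'; apply => //.
  + exact: measurableT_comp.
  + by move=> a t; rewrite alphaE.
  + exact: (pre _ _ mT' mTU).
- move=> k; rewrite /= /pushforward lebmE; apply: (le_lt_trans (le _ _ (mg k) (og k) erefl)).
  have [|_ +] := @lebesgue_box R n (fun=> - k%:R) (fun=> k%:R).
    by move=> i; rewrite lerNl (le_trans _ (ler0n _ _))// oppr_le0.
  rewrite (_ : mkset _ = g k) => [->|]; first exact: ltry.
  by apply/seteqP; split=> t gt i; have := gt i; rewrite /= ltr_norml.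
Qed.

End Twist.

End TwistPreserving.

(** * Jacobians *)

Section Jacobian.
Context {R : realType}.

Lemma jacobian_comp m n p (f : 'rV[R]_m -> 'rV[R]_n) (g : 'rV[R]_n -> 'rV[R]_p) x :
  differentiable f x -> differentiable g (f x) ->
  'J (g \o f) x = 'J f x *m 'J g (f x).
Proof.
move=> df dg; apply/row_matrixP => i; rewrite !rowE mulmxA.
by rewrite /jacobian !mul_rV_lin1 diff_comp.
Qed.

Lemma jacobian_id n (x : 'rV[R]_n) : 'J (@id 'rV[R]_n) x = 1%:M.
Proof.
apply/row_matrixP => i; rewrite !rowE /jacobian mul_rV_lin1 mulmx1.
by rewrite diff_val.
Qed.

Lemma jacobian_det_neq0 n (f g : 'rV[R]_n -> 'rV[R]_n) x :
  differentiable f x -> differentiable g (f x) -> cancel f g ->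
  \det ('J f x) != 0.
Proof.
move=> df dg fK.
have factor (a b : R) : a * b = 1 -> a != 0.
  by move=> ab; apply/eqP => a0; move/eqP: ab; rewrite a0 mul0r eq_sym oner_eq0.
apply: (factor _ (\det ('J g (f x)))).
rewrite -det_mulmx -(jacobian_comp df dg) (_ : g \o f = id).
  by rewrite jacobian_id det1.
by apply/funext => y /=.
Qed.

(** The differential is chosen among the linear maps that satisfy its defining
    expansion, and this expansion depends on the germ only. *)
Lemma near_jacobian m n (f g : 'rV[R]_m -> 'rV[R]_n) x :
  {near x, f =1 g} -> 'J f x = 'J g x.
Proof.
move=> fg; suff : 'd f x = 'd g x by rewrite /jacobian => ->.
rewrite /diff; apply: (congr1 get); apply/funext => df; apply/propext.
suff imp (f1 g1 : 'rV[R]_m -> 'rV[R]_n) : {near x, f1 =1 g1} ->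
    (forall y, f1 y = f1 (lim (nbhs x)) + df (y - lim (nbhs x))
      +o_(y \near x) (y - lim (nbhs x))) ->
    (forall y, g1 y = g1 (lim (nbhs x)) + df (y - lim (nbhs x))
      +o_(y \near x) (y - lim (nbhs x))).
  have gf : {near x, g =1 f} by apply: filterS fg => y ->.
  by split=> -[cdf E]; (split; first exact: cdf);
    [exact: (imp f g fg E)|exact: (imp g f gf E)].
rewrite lim_id// => fg1 /funext/eqaddoP E.
suff : g1 = (fun y => g1 x + df (y - x)) +o_ x (fun y => y - x).
  by move=> H y; rewrite {1}H.
apply/eqaddoP => e e0; have fx : f1 x = g1 x by exact: nbhs_singleton fg1.
by have := E e e0; apply: filterS2 fg1 => y; rewrite !fctE fx => ->.
Qed.

End Jacobian.

(** * Rotations about a point in the plane of the first two coordinates *)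

Section Rotation.
Context {R : realType} {m : nat}.
Notation n := m.+2.
Implicit Types (c x y : 'rV[R]_n) (a b k e : R).

Notation i0 := (ord0 : 'I_n).
Notation i1 := (lift ord0 ord0 : 'I_n).

Definition rotation c a x : 'rV[R]_n := \row_j
  if j == i0 then c 0 i0 + (cos a * (x 0 i0 - c 0 i0) - sin a * (x 0 i1 - c 0 i1))
  else if j == i1 then
    c 0 i1 + (sin a * (x 0 i0 - c 0 i0) + cos a * (x 0 i1 - c 0 i1))
  else x 0 j.

Lemma rotE0 c a x : rotation c a x 0 i0 =
  c 0 i0 + (cos a * (x 0 i0 - c 0 i0) - sin a * (x 0 i1 - c 0 i1)).
Proof. by rewrite mxE eqxx. Qed.

Lemma rotE1 c a x : rotation c a x 0 i1 =
  c 0 i1 + (sin a * (x 0 i0 - c 0 i0) + cos a * (x 0 i1 - c 0 i1)).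
Proof. by rewrite mxE eqxx. Qed.

Lemma rotE2 c a x j : rotation c a x 0 (lift ord0 (lift ord0 j)) =
  x 0 (lift ord0 (lift ord0 j)).
Proof. by rewrite mxE. Qed.

Lemma rowP2 (x y : 'rV[R]_n) : x 0 i0 = y 0 i0 -> x 0 i1 = y 0 i1 ->
  (forall j, x 0 (lift ord0 (lift ord0 j)) = y 0 (lift ord0 (lift ord0 j))) ->
  x = y.
Proof.
move=> e0 e1 e2; apply/rowP => j.
case: (unliftP ord0 j) => [j' ->|->//].
by case: (unliftP ord0 j') => [j'' ->|->].
Qed.

Lemma rotation0 c x : rotation c 0 x = x.
Proof.
by apply: rowP2 => [||j]; rewrite ?rotE0 ?rotE1 ?rotE2// cos0 sin0; ring.
Qed.

Lemma rotationD c a b x : rotation c (a + b) x = rotation c a (rotation c b x).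
Proof.
apply: rowP2 => [||j]; rewrite ?(rotE0, rotE1, rotE2)// cosD sinD; ring.
Qed.

Definition sqdist c x : R := \sum_i (x 0 i - c 0 i) ^+ 2.

Lemma sqdist_rot c a x : sqdist c (rotation c a x) = sqdist c x.
Proof.
rewrite /sqdist !big_ord_recl/= rotE0 rotE1 addrA [RHS]addrA; congr (_ + _).
  set u := x 0 i0 - _; set v := x 0 i1 - _.
  have := cos2Dsin2 a; set p := cos a; set q := sin a => pq.
  transitivity ((p ^+ 2 + q ^+ 2) * (u ^+ 2 + v ^+ 2)); first by ring.
  by rewrite pq mul1r.
by apply: eq_bigr => j _; rewrite rotE2.
Qed.

Lemma elementary_sqdist c : elementary (sqdist c).
Proof.
rewrite /sqdist; apply: elementary_sum => i.
rewrite (_ : (fun x => _) = fun x : 'rV[R]_n =>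
  (x 0 i - c 0 i) * (x 0 i - c 0 i)).
  by apply: elementaryM; apply: elementaryB;
    [exact: elementary_coord|exact: elementary_cst
    |exact: elementary_coord|exact: elementary_cst].
by apply/funext => x; rewrite expr2.
Qed.

Lemma elementary_rot p c (A : 'rV[R]_p -> R) (X : 'rV[R]_p -> 'rV[R]_n) i :
  elementary A -> (forall i, elementary (fun z => X z 0 i)) ->
  elementary (fun z => rotation c (A z) (X z) 0 i).
Proof.
move=> eA eX.
have eD j : elementary (fun z => X z 0 j - c 0 j).
  by apply: elementaryB => //; exact: elementary_cst.
have eC : elementary (fun z => cos (A z)).
  exact: (elementary_comp smooth1_cos eA).
have eS : elementary (fun z => sin (A z)).
  exact: (elementary_comp smooth1_sin eA).
rewrite (_ : (fun z => _) = fun z =>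
  if i == i0 then c 0 i0 + (cos (A z) * (X z 0 i0 - c 0 i0)
    - sin (A z) * (X z 0 i1 - c 0 i1))
  else if i == i1 then
    c 0 i1 + (sin (A z) * (X z 0 i0 - c 0 i0) + cos (A z) * (X z 0 i1 - c 0 i1))
  else X z 0 i); last by apply/funext => z; rewrite mxE.
case: (i == i0).
  apply: elementaryD; first exact: elementary_cst.
  by apply: elementaryB; exact: elementaryM.
case: (i == i1) => //.
apply: elementaryD; first exact: elementary_cst.
by apply: elementaryD; exact: elementaryM.
Qed.

Lemma preserving_rot c a : preserving (fun t => tv (rotation c a (rv t))).
Proof.
have := @preserving_affine R m (cos a) (sin a)
  (c 0 i0 - (cos a * c 0 i0 - sin a * c 0 i1))
  (c 0 i1 - (sin a * c 0 i0 + cos a * c 0 i1)) (cos2Dsin2 a).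
move=> H; apply: (eq_preserving _ H) => t; apply: (can_inj (@rvK R n)); rewrite tvK.
apply: rowP2 => [||j].
- rewrite rotE0 !mxE tnth0.
  have -> : thead (tdrop t) = tnth t i1 by rewrite -tnth_tdrop.
  rewrite /thead /=; ring.
- rewrite rotE1 !mxE tnthS tnth0.
  have -> : thead (tdrop t) = tnth t i1 by rewrite -tnth_tdrop.
  rewrite /thead /=; ring.
- by rewrite rotE2 !mxE !tnthS !tnth_tdrop.
Qed.

Lemma rot_derive_cst c a v x y : 'D_v (rotation c a) x = 'D_v (rotation c a) y.
Proof.
rewrite /derive; set F := fun h => _; set G := fun h => _.
suff -> : F = G by [].
apply/funext => h; rewrite /F /G; congr (_ *: _).
apply: rowP2 => [||j]; rewrite !mxE ?eqxx /=; ring.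
Qed.

Lemma elementary_id i : elementary (fun x : 'rV[R]_n => x 0 i).
Proof. exact: elementary_coord. Qed.

Lemma differentiable_rot c a x : differentiable (rotation c a) x.
Proof.
apply: elementary_row_differentiable => i; apply: elementary_rot.
  exact: elementary_cst.
exact: elementary_id.
Qed.

Lemma jacobian_rot_cst c a x y : 'J (rotation c a) x = 'J (rotation c a) y.
Proof.
apply/row_matrixP => i; rewrite [LHS]rowE [RHS]rowE.
have E z := deriveEjacobian (delta_mx 0 i) (differentiable_rot c a z).
exact: (etrans (esym (E x)) (etrans (rot_derive_cst c a _ x y) (E y))).
Qed.

Lemma rot_continuous_angle c x : continuous (fun a => rotation c a x).
Proof.
have trig (w p q : R) : continuous (fun a : R => w + (p * cos a + q * sin a)).
  move=> a; apply: cvgD; first exact: cvg_cst.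
  exact: (smooth1_continuous (smooth1_trig p q)).
move=> a; apply: (@cvg_rowP _ _ _ (nbhs a)) => i.
set u := x 0 i0 - c 0 i0; set v := x 0 i1 - c 0 i1.
have [->|n0] := eqVneq i i0.
  have E b : rotation c b x 0 i0 = c 0 i0 + (u * cos b + - v * sin b).
    by rewrite rotE0 -/u -/v; ring.
  by rewrite E (funext E); exact: trig.
have [->|n1] := eqVneq i i1.
  have E b : rotation c b x 0 i1 = c 0 i1 + (v * cos b + u * sin b).
    by rewrite rotE1 -/u -/v; ring.
  by rewrite E (funext E); exact: trig.
rewrite (_ : (fun b => _) = cst (x 0 i)); last first.
  by apply/funext => b; rewrite mxE (negbTE n0) (negbTE n1).
by rewrite mxE (negbTE n0) (negbTE n1); exact: cvg_cst.
Qed.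

Section Twist.
Variables (c : 'rV[R]_n) (A : 'rV[R]_n -> R).
Hypothesis eA : elementary A.
Hypothesis A_rot : forall a x, A (rotation c a x) = A x.

Let elementary_twist (B : 'rV[R]_n -> R) : elementary B ->
  forall i, elementary (fun x => rotation c (B x) x 0 i).
Proof. by move=> eB i; apply: elementary_rot => //; exact: elementary_id. Qed.

Lemma twist_preserves : preserving (fun t => tv (rotation c (A (rv t)) (rv t))).
Proof.
have := @twist_preserving R n (fun a t => tv (rotation c a (rv t))) _ _ _ _
  (fun t => A (rv t)).
apply.
- by move=> t; rewrite rotation0 rvK.
- by move=> a b t; rewrite rotationD tvK.
- exact: preserving_rot.
- move=> t; rewrite (_ : (fun a => _) = fun a => rotation c a (rv t)).
    exact: rot_continuous_angle.
  by apply/funext => a; rewrite tvK.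
- exact: (elementary_measurable eA).
- by move=> a t; rewrite tvK A_rot.
- exact: (elementary_row_measurable (elementary_twist eA)).
- exact: (elementary_row_measurable (elementary_twist (elementaryN eA))).
- rewrite (_ : (fun v => _) = fun v => rotation c (A v) v).
    exact: (elementary_row_continuous (elementary_twist eA)).
  by apply/funext => v; rewrite !tvK.
Qed.

(** The twist is the square of the twist by half the angle; the half twist
    coincides at x with a rotation, with which it commutes, so its jacobian
    determinants at the two points x and rotation x agree, and the determinant of
    the full twist is a square. *)
Lemma twist_det_gt0 x : 0 < \det ('J (fun y => rotation c (A y) y) x).
Proof.
pose h y := A y / 2; pose S y := rotation c (h y) y.
pose S' y := rotation c (- h y) y.
have eh : elementary h by apply: elementaryM => //; exact: elementary_cst.
have h_rot a y : h (rotation c a y) = h y by rewrite /h A_rot.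
have dS y : differentiable S y.
  by apply: elementary_row_differentiable; exact: elementary_twist.
have dS' y : differentiable S' y.
  apply: elementary_row_differentiable; apply: elementary_twist.
  exact: elementaryN.
have TE : (fun y => rotation c (A y) y) = S \o S.
  by apply/funext => y; rewrite /= /S h_rot -rotationD /h -splitr.
have inv y : \det ('J S y) != 0.
  apply: (jacobian_det_neq0 (dS y) (dS' (S y))) => z.
  by rewrite /S' /S h_rot -rotationD addNr rotation0.
pose Q := rotation c (h x).
have dQ y : differentiable Q y by exact: differentiable_rot.
have invQ : \det ('J Q x) != 0.
  apply: (jacobian_det_neq0 (dQ x) (differentiable_rot c (- h x) (Q x))) => z.
  by rewrite /Q -rotationD addNr rotation0.
have comm : S \o Q = Q \o S.
  by apply/funext => z; rewrite /= /S /Q h_rot -!rotationD addrC.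
have dets (J A1 B C D : 'M[R]_n) : J = A1 *m B -> J = C *m D -> D = A1 ->
    \det A1 != 0 -> \det B = \det C.
  move=> JAB JCD DA A0; apply: (mulfI A0); rewrite -det_mulmx -JAB JCD DA.
  by rewrite det_mulmx mulrC.
have square (J B C : 'M[R]_n) : J = C *m B -> \det B = \det C ->
    \det C != 0 -> 0 < \det J.
  move=> -> + C0; rewrite det_mulmx => ->.
  by rewrite -expr2 exprn_even_gt0//= C0 orbT.
have E1 := jacobian_comp (dQ x) (dS (Q x)).
have E2 := jacobian_comp (dS x) (dQ (S x)).
have E3 := jacobian_comp (dS x) (dS (S x)).
rewrite -TE in E3; rewrite comm in E1.
apply: (square _ _ _ E3); last exact: inv.
exact: (dets _ _ _ _ _ E1 E2 (jacobian_rot_cst c (h x) (S x) x) invQ).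
Qed.

End Twist.
End Rotation.

(** * Bump functions *)

Section Bump.
Context {R : realType}.

Definition bump (a b s : R) : R := flat 1 (s - a) * flat 1 (b - s).

Lemma flat1_ge0 (x : R) : 0 <= flat 1 x.
Proof.
by rewrite /flat; case: ifP => // _; rewrite hornerC mul1r expR_ge0.
Qed.

Lemma flat1_gt0 (x : R) : 0 < x -> 0 < flat 1 x.
Proof. by move=> x0; rewrite /flat x0 hornerC mul1r expR_gt0. Qed.

Lemma flat1_le1 (x : R) : flat 1 x <= 1.
Proof.
rewrite /flat; case: ifPn => // x0.
by rewrite hornerC mul1r expR_le1 oppr_le0 invr_ge0 ltW.
Qed.

Lemma flat1_0 (x : R) : x <= 0 -> flat 1 x = 0.
Proof. by move=> x0; rewrite /flat ltNge x0. Qed.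

Lemma bump_ge0 a b s : 0 <= bump a b s.
Proof. by rewrite mulr_ge0// flat1_ge0. Qed.

Lemma bump_le1 a b s : bump a b s <= 1.
Proof. by rewrite mulr_ile1// ?flat1_ge0// flat1_le1. Qed.

Lemma bump_gt0 a b s : a < s < b -> 0 < bump a b s.
Proof.
by move=> /andP[as_ sb]; rewrite mulr_gt0// flat1_gt0// subr_gt0.
Qed.

Lemma bump0l a b s : s <= a -> bump a b s = 0.
Proof. by move=> sa; rewrite /bump flat1_0 ?mul0r// subr_le0. Qed.

Lemma bump0r a b s : b <= s -> bump a b s = 0.
Proof. by move=> sa; rewrite /bump (@flat1_0 (b - s)) ?mulr0// subr_le0. Qed.

Lemma elementary_bump m a b (f : 'rV[R]_m -> R) :
  elementary f -> elementary (fun x => bump a b (f x)).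
Proof.
move=> ef; rewrite /bump.
by apply: elementaryM; apply: elementary_comp (smooth1_flat _) _;
  apply: elementaryB => //; exact: elementary_cst.
Qed.

End Bump.

(** * Euclidean balls *)

Section Balls.
Context {R : realType} {m : nat}.
Notation n := m.+2.
Implicit Types (c x y : 'rV[R]_n).

Lemma dotv_sqdist c x : dotv (x - c) (x - c) = sqdist c x.
Proof. by apply: eq_bigr => i _; rewrite !mxE expr2. Qed.

Lemma eballE c r x : 0 < r -> eball c r x <-> sqdist c x < r ^+ 2.
Proof.
move=> r0; rewrite /eball /= /enorm dotv_sqdist.
have E : r = Num.sqrt (r ^+ 2) by rewrite sqrtr_sqr gtr0_norm.
by rewrite {1}E ltr_sqrt ?exprn_gt0.
Qed.

Lemma coord_le_sqdist c x i : (x 0 i - c 0 i) ^+ 2 <= sqdist c x.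
Proof.
rewrite /sqdist (bigD1 i)//= lerDl; apply: sumr_ge0 => j _; exact: sqr_ge0.
Qed.

Lemma eball_coord c r x i : eball c r x -> `|x 0 i - c 0 i| < r.
Proof.
move=> Bx; have r0 : 0 < r.
  by move: Bx; rewrite /eball /=; apply: le_lt_trans; exact: sqrtr_ge0.
move: Bx => /(eballE _ _ r0) h.
have : `|x 0 i - c 0 i| ^+ 2 < r ^+ 2.
  rewrite real_normK ?num_real//; exact: le_lt_trans (coord_le_sqdist _ _ _) h.
by rewrite ltr_pXn2r ?nnegrE ?(ltW r0).
Qed.

Lemma open_eball c r : 0 < r -> open (eball c r).
Proof.
move=> r0; rewrite (_ : eball c r = sqdist c @^-1` [set s | s < r ^+ 2]).
  apply: open_comp; last exact: open_lt.
  by move=> x _; exact: (elementary_continuous (elementary_sqdist c)).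
by apply/seteqP; split=> x /(eballE _ _ r0).
Qed.

End Balls.

(** * Twists in a disjoint family of balls *)

Section Family.
Context {R : realType} {m : nat}.
Notation n := m.+2.
Variables (c : nat -> 'rV[R]_n) (r : nat -> R).
Hypothesis r_gt0 : forall j, 0 < r j.
Hypothesis disjoint_balls : trivIset [set: nat] (fun j => eball (c j) (r j)).
Implicit Types (x y : 'rV[R]_n) (j : nat).

Let B j : set 'rV[R]_n := eball (c j) (r j).

(** Squared distance to the centre, normalized so that the ball is reldist < 1. *)
Definition reldist j x : R := sqdist (c j) x / r j ^+ 2.

Definition fast j x : R := bump 0 2^-1 (reldist j x).
Definition slow j x : R := bump 2^-1 (3 / 4) (reldist j x).

(** The angle oscillates with amplitude k in the inner part of the ball, and
    advances with amplitude e in an outer shell. *)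
Definition angle j (k e : R) x : R := k * fast j x + e * slow j x.

Definition twist j (k e : R) x : 'rV[R]_n := rotation (c j) (angle j k e x) x.

Lemma reldist_lt1 j x : B j x <-> reldist j x < 1.
Proof.
by rewrite /B (eballE _ _ (r_gt0 j)) /reldist ltr_pdivrMr ?exprn_gt0// mul1r.
Qed.

Lemma reldist_rot j a x : reldist j (rotation (c j) a x) = reldist j x.
Proof. by rewrite /reldist sqdist_rot. Qed.

Lemma angle_rot j k e a x : angle j k e (rotation (c j) a x) = angle j k e x.
Proof. by rewrite /angle /fast /slow reldist_rot. Qed.

Lemma twist_ball j k e x : B j (twist j k e x) <-> B j x.
Proof. by rewrite !reldist_lt1 reldist_rot. Qed.

Lemma angle_out j k e x : 3 / 4 <= reldist j x -> angle j k e x = 0.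
Proof.
move=> h; rewrite /angle /fast /slow !bump0r ?mulr0 ?addr0//.
by apply: le_trans h; lra.
Qed.

Lemma twist_out j k e x : 3 / 4 <= reldist j x -> twist j k e x = x.
Proof. by move=> h; rewrite /twist angle_out// rotation0. Qed.

Lemma twist_notin j k e x : ~ B j x -> twist j k e x = x.
Proof.
rewrite reldist_lt1 => /negP; rewrite -leNgt => h; apply: twist_out.
by apply: le_trans h; lra.
Qed.

Lemma twist0 j x : twist j 0 0 x = x.
Proof. by rewrite /twist /angle !mul0r addr0 rotation0. Qed.

Lemma twistK j k e x : twist j (- k) (- e) (twist j k e x) = x.
Proof.
rewrite /twist angle_rot -rotationD (_ : _ + _ = 0) ?rotation0//.
by rewrite /angle !mulNr -opprD addNr.
Qed.

Lemma elementary_reldist j : elementary (reldist j).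
Proof.
by apply: elementaryM; [exact: elementary_sqdist|exact: elementary_cst].
Qed.

Lemma elementary_fast j : elementary (fast j).
Proof. exact: (elementary_bump _ _ (elementary_reldist j)). Qed.

Lemma elementary_slow j : elementary (slow j).
Proof. exact: (elementary_bump _ _ (elementary_reldist j)). Qed.

Lemma elementary_angle p j (k e : 'rV[R]_p -> R) (X : 'rV[R]_p -> 'rV[R]_n) :
  elementary k -> elementary e -> (forall i, elementary (fun z => X z 0 i)) ->
  elementary (fun z => angle j (k z) (e z) (X z)).
Proof.
move=> ek ee eX; apply: elementaryD; apply: elementaryM => //.
  exact: (elementary_subst (elementary_fast j) eX).
exact: (elementary_subst (elementary_slow j) eX).
Qed.

Lemma elementary_twist p j (k e : 'rV[R]_p -> R) (X : 'rV[R]_p -> 'rV[R]_n) i :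
  elementary k -> elementary e -> (forall i, elementary (fun z => X z 0 i)) ->
  elementary (fun z => twist j (k z) (e z) (X z) 0 i).
Proof.
by move=> ek ee eX; apply: elementary_rot => //; exact: elementary_angle.
Qed.

Lemma elementary_angle_fixed j (k e : R) : elementary (angle j k e).
Proof.
by apply: (@elementary_angle _ j (fun=> k) (fun=> e) id) => *;
  [exact: elementary_cst|exact: elementary_cst|exact: elementary_coord].
Qed.

Lemma elementary_twist_fixed j (k e : R) i :
  elementary (fun x => twist j k e x 0 i).
Proof.
by apply: (@elementary_twist _ j (fun=> k) (fun=> e) id) => *;
  [exact: elementary_cst|exact: elementary_cst|exact: elementary_coord].
Qed.

Lemma preserving_twist j (k e : R) : preserving (fun t => tv (twist j k e (rv t))).
Proof.
apply: (twist_preserves (elementary_angle_fixed j k e)) => a x.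
exact: angle_rot.
Qed.

Lemma twist_displacement j k e x i :
  `|twist j k e x 0 i - x 0 i| <= 2 * r j.
Proof.
have [Bx|nBx] := pselect (B j x); last first.
  by rewrite twist_notin// subrr normr0 mulr_ge0// ltW.
have h1 := eball_coord i Bx.
have h2 := eball_coord i ((twist_ball j k e x).2 Bx).
move: h1 h2; rewrite !ltr_norml => /andP[h1 h2] /andP[h3 h4].
by rewrite ler_norml; apply/andP; split; lra.
Qed.

(** The index 0 is a harmless default, since every twist is the identity
    outside of its ball. *)
Definition ball_index x : nat := xget 0%N [set j | B j x].

Definition twists (k e : nat -> R) x : 'rV[R]_n :=
  twist (ball_index x) (k (ball_index x)) (e (ball_index x)) x.

Lemma ball_inj i j x : B i x -> B j x -> i = j.
Proof. by move=> Bi Bj; apply: disjoint_balls => //; exists x. Qed.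

Lemma twists_in j k e x : B j x -> twists k e x = twist j (k j) (e j) x.
Proof.
move=> Bj; rewrite /twists /ball_index.
by case: xgetP => [i _ /= Bi|/(_ j)//]; rewrite (ball_inj Bi Bj).
Qed.

Lemma twists_notin k e x : (forall j, ~ B j x) -> twists k e x = x.
Proof. by move=> nB; rewrite /twists twist_notin. Qed.

Variant ball_spec x : Prop :=
| InBall j of B j x
| OutBalls of forall j, ~ B j x.

Lemma some_ballP x : ball_spec x.
Proof.
have [[j Bj]|nB] := pselect (exists j, B j x); first exact: (InBall Bj).
by apply: OutBalls => j Bj; apply: nB; exists j.
Qed.

Lemma twistsK k e x :
  twists (fun j => - k j) (fun j => - e j) (twists k e x) = x.
Proof.
case: (some_ballP x) => [j Bj|nB]; last by rewrite !(twists_notin _ _ nB).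
by rewrite (twists_in _ _ Bj) (twists_in (j := j)) ?twistK//; exact/twist_ball.
Qed.

Lemma twistsNK k e x :
  twists k e (twists (fun j => - k j) (fun j => - e j) x) = x.
Proof.
have := twistsK (fun j => - k j) (fun j => - e j) x.
by under eq_fun do rewrite opprK; under [X in twists _ X]eq_fun do rewrite opprK.
Qed.

Lemma preserving_twists k e : preserving (fun t => tv (twists k e (rv t))).
Proof.
pose P i : set (n.-tuple R) := if i is j.+1 then [set t | B j (rv t)]
  else [set t | forall j, ~ B j (rv t)].
pose F i (t : n.-tuple R) := if i is j.+1 then tv (twist j (k j) (e j) (rv t))
  else t.
have mB j : measurable [set t : n.-tuple R | B j (rv t)].
  have := elementary_measurable (elementary_reldist j) measurableT
    (measurable_itv `]-oo, 1[).
  rewrite setTI; congr measurable; apply/seteqP; split=> t /=;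
    by rewrite in_itv/= reldist_lt1.
apply: (@preserving_glue _ _ P F).
- case=> [|j] //=.
  rewrite (_ : mkset _ = \bigcap_j ~` [set t : n.-tuple R | B j (rv t)]).
    by apply: bigcapT_measurable => j; exact: measurableC.
  by apply/seteqP; split=> t /= h j; [move=> _; exact: h|exact: h].
- move=> [|i] [|j] _ _ [t [/= ht1 ht2]] //.
  + by have := ht1 _ ht2.
  + by have := ht2 _ ht1.
  + by rewrite (ball_inj ht1 ht2).
- apply/seteqP; split=> // t _.
  case: (some_ballP (rv t)) => [j Bj|nB]; last by exists 0%N.
  by exists j.+1.
- case=> [|j]; [exact: preserving_id|exact: preserving_twist].
- by case=> [|j] t //=; rewrite tvK twist_ball.
- case=> [|j] t /= h; first by rewrite twists_notin// rvK.
  by rewrite (twists_in _ _ h).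
Qed.

Hypothesis r_cvg0 : r j @[j --> \oo] --> 0.

(** Uniform limit of the maps that twist only the first balls. *)
Lemma twists_continuous k e : continuous (twists k e).
Proof.
pose S N x := \row_i (x 0 i + \sum_(j < N) (twist j (k j) (e j) x 0 i - x 0 i)).
have cS N : continuous (S N).
  apply: elementary_row_continuous => i.
  rewrite (_ : (fun x => _) = fun x : 'rV[R]_n =>
    x 0 i + \sum_(j < N) (twist j (k j) (e j) x 0 i - x 0 i)).
    apply: elementaryD; first exact: elementary_coord.
    apply: elementary_sum => j; apply: elementaryB; last exact: elementary_coord.
    exact: elementary_twist_fixed.
  by apply/funext => x; rewrite mxE.
have close (d : R) : 0 < d -> exists N, forall x, `|twists k e x - S N x| <= d.
  move=> d0.
  have [N _ HN] := (cvgr0Pnorm_le r).1 r_cvg0 (d / 2) (divr_gt0 d0 (ltr0Sn _ _)).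
  exists N => x.
  rewrite /Num.Def.normr/= mx_normrE (bigmax_le _ (ltW d0))//= => -[i0 i] _.
  rewrite (ord1 i0) /= {i0}.
  have -> : (twists k e x - S N x) 0 i = twists k e x 0 i -
      (x 0 i + \sum_(j < N) (twist j (k j) (e j) x 0 i - x 0 i)).
    by rewrite mxE; congr (_ + _); rewrite mxE; congr (- _); rewrite mxE.
  case: (some_ballP x) => [j Bj|nB]; last first.
    rewrite twists_notin// big1 ?addr0 ?subrr ?normr0 ?ltW// => j _.
    by rewrite twist_notin ?subrr.
  rewrite (twists_in _ _ Bj).
  have other l : l != j -> twist l (k l) (e l) x 0 i - x 0 i = 0.
    move=> lj; rewrite twist_notin ?subrr// => Bl.
    by move: lj; rewrite (ball_inj Bl Bj) eqxx.
  have [jN|Nj] := ltnP j N.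
    rewrite (bigD1 (Ordinal jN))//= big1 => [|l lj]; last exact: other.
    by rewrite addr0 subrKC subrr normr0 ltW.
  rewrite big1 => [|l _]; last first.
    by apply: other; rewrite neq_ltn (leq_trans (ltn_ord l) Nj).
  rewrite addr0; apply: le_trans (twist_displacement _ _ _ _ _) _.
  have := HN j Nj; rewrite /= gtr0_norm ?r_gt0// => h; lra.
move=> x; apply/(@cvgrPdist_le _ _ _ (nbhs x)) => d d0.
have [N HN] := close (d / 3) (divr_gt0 d0 (ltr0Sn _ _)).
near=> y.
have h1 := HN x; have h2 := HN y.
have h3 : `|S N x - S N y| <= d / 3.
  by near: y; exact: (@cvgrPdist_le _ _ _ (nbhs x) _ _ _).1 (cS N x) _ (divr_gt0 d0 (ltr0Sn _ _)).
have -> : twists k e x - twists k e y = (twists k e x - S N x) +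
    ((S N x - S N y) + - (twists k e y - S N y)) by rewrite opprB !subrKA.
apply: (le_trans (ler_normD _ _)).
apply: (le_trans (lerD (lexx _) (ler_normD _ _))).
rewrite normrN; lra.
Unshelve. all: by end_near. Qed.

End Family.

(** * Volume preserving diffeomorphisms and isotopies of the cube *)

Section FamilyInCube.
Context {R : realType} {m : nat}.
Notation n := m.+2.
Variables (c : nat -> 'rV[R]_n) (r : nat -> R).
Hypothesis r_gt0 : forall j, 0 < r j.
Hypothesis disjoint_balls : trivIset [set: nat] (fun j => eball (c j) (r j)).
Hypothesis r_cvg0 : r j @[j --> \oo] --> 0.
Implicit Types (x y : 'rV[R]_n) (j : nat).

Let B j : set 'rV[R]_n := eball (c j) (r j).

Hypothesis balls_cube : forall j, B j `<=` @cube R n.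
Hypothesis balls_locally_finite : forall y, (@cube R n)^° y ->
  exists2 U, nbhs y U & finite_set [set j | B j `&` U !=set0].

Lemma ball_nbhs j x : B j x -> nbhs x (B j).
Proof. by move=> Bx; apply: open_nbhs_nbhs; split=> //; exact: open_eball. Qed.

Lemma ball_interior j x : B j x -> (@cube R n)^° x.
Proof. by move=> Bx; apply: filterS (ball_nbhs Bx); exact: balls_cube. Qed.

(** Only finitely many balls come near y, and y lies outside of the closed
    supports, which reach only up to relative squared distance 3 / 4. *)
Lemma twists_id_near y : (@cube R n)^° y -> (forall j, ~ B j y) ->
  \forall x \near y, forall k e, twists c r k e x = x.
Proof.
move=> Cy nB; have [U Uy finU] := balls_locally_finite Cy.
have [N HN] : exists N, forall j, (B j `&` U) !=set0 -> (j < N)%N.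
  have /finite_seqP[s sE] := finU.
  exists (\max_(i <- s) i).+1 => j hj; rewrite ltnS.
  have js : j \in s by have : [set` s] j by rewrite -sE.
  exact: (@leq_bigmax_seq _ s xpredT id).
have far : \forall x \near y, forall j : 'I_N, 3 / 4 < reldist c r j x.
  pose f (j : 'I_N) : set 'rV[R]_n := [set x | 3 / 4 < reldist c r j x].
  apply: (@filter_forall _ _ f (nbhs y)) => j.
  have h : 3 / 4 < reldist c r j y.
    have := nB j; rewrite /B (reldist_lt1 c r_gt0) => /negP; rewrite -leNgt.
    by apply: lt_le_trans; lra.
  exact: (elementary_continuous (elementary_reldist c r j) (lt_nbhsr h)).
near=> x; move=> k e.
have Ux : U x by near: x.
have fx : forall j : 'I_N, 3 / 4 < reldist c r j x by near: x.
case: (some_ballP c r x) => [j Bj|nBx]; last exact: (twists_notin r_gt0).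
have jN : (j < N)%N by apply: HN; exists x.
by rewrite (twists_in disjoint_balls _ _ Bj)// twist_out// ltW// (fx (Ordinal jN)).
Unshelve. all: by end_near. Qed.

(** With X = id and constant parameters this is smoothness of a single map;
    with time among the variables it is smoothness of the isotopy. *)
Lemma twists_smooth p (A : set 'rV[R]_p) (k e : nat -> 'rV[R]_p -> R)
    (X : 'rV[R]_p -> 'rV[R]_n) :
  (forall j, elementary (k j)) -> (forall j, elementary (e j)) ->
  (forall i, elementary (fun z => X z 0 i)) ->
  (forall z, A z -> (@cube R n)^° (X z)) ->
  smooth_on A (fun z => twists c r (k^~ z) (e^~ z) (X z)).
Proof.
move=> ek ee eX AX z Az.
have cX := elementary_row_continuous eX.
case: (some_ballP c r (X z)) => [j Bj|nB].
  exists (X @^-1` B j), (fun z => twist c r j (k j z) (e j z) (X z)); split=> //.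
  - by apply: open_comp => [w _|]; [exact: cX|exact: open_eball].
  - move=> l; apply: elementary_row_Ck => i.
    by apply: elementary_twist.
  - move=> w; rewrite inE => -[_ Bw]; exact: (twists_in disjoint_balls _ _ Bw).
pose V := [set x | forall k e, twists c r k e x = x]^°.
exists (X @^-1` V), X; split.
- by apply: open_comp => [w _|]; [exact: cX|exact: open_interior].
- exact: twists_id_near (AX _ Az) nB.
- by move=> l; exact: elementary_row_Ck.
- by move=> w; rewrite inE => -[_ /interior_subset]; exact.
Qed.

Lemma twists_cube k e x : @cube R n x -> @cube R n (twists c r k e x).
Proof.
move=> Cx; case: (some_ballP c r x) => [j Bj|nB]; last by rewrite twists_notin.
by rewrite (twists_in disjoint_balls _ _ Bj)//; apply: (balls_cube (j := j)); exact/twist_ball.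
Qed.

Lemma SDiff_twists k e : SDiff (twists c r k e).
Proof.
pose k' j := - k j; pose e' j := - e j.
have fK := twistsK r_gt0 disjoint_balls k e.
have gK := twistsNK r_gt0 disjoint_balls k e.
have cont k1 e1 : continuous (twists c r k1 e1).
  exact: twists_continuous.
have sm k1 e1 : smooth_on (@cube R n)^° (twists c r k1 e1).
  apply: (@twists_smooth _ _ (fun j => fun=> k1 j) (fun j => fun=> e1 j) id) => //.
  - by move=> j; exact: elementary_cst.
  - by move=> j; exact: elementary_cst.
  - by move=> i; exact: elementary_coord.
split.
- exists (twists c r k' e'); split.
  + split.
    * by move=> x Cx; exact: twists_cube.
    * by move=> x y _ _ E; rewrite -(fK x) -(fK y) E.
    * move=> y Cy; exists (twists c r k' e' y); last exact: gK.
      exact: twists_cube.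
  + by move=> x _; exact: fK.
  + exact/continuous_subspaceT/cont.
  + exact/continuous_subspaceT/cont.
  + by [].
- have id_boundary x : @cube_boundary R n x -> twists c r k e x = x.
    move=> [_ nI]; apply: twists_notin => // j Bj.
    by apply: nI; exact: ball_interior Bj.
  apply/seteqP; split=> x; first by move=> [y bdy <-]; rewrite id_boundary.
  by move=> bdx; exists x => //; exact: id_boundary.
- move=> x Cx; case: (some_ballP c r x) => [j Bj|nB].
    rewrite (@near_jacobian _ _ _ _ (twist c r j (k j) (e j))).
      apply: twist_det_gt0; first exact: elementary_angle_fixed.
      by move=> a y; exact: angle_rot.
    by apply: filterS (ball_nbhs Bj) => y By; exact: (twists_in disjoint_balls _ _ By).
  rewrite (@near_jacobian _ _ _ _ id) ?jacobian_id ?det1 ?ltr01//.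
  by apply: filterS (twists_id_near Cx nB) => y; exact.
- move=> A mA AC; rewrite -((preserving_twists r_gt0 disjoint_balls k e).2 A mA).
  congr lebesgue; apply/seteqP; split=> t /=.
    by move=> [_ [s As E]]; rewrite -E rvK.
  move=> At; split; last by exists (tv (twists c r k e (rv t))); rewrite ?tvK.
  have : @cube R n (twists c r k e (rv t)).
    by apply: AC; exists (tv (twists c r k e (rv t))); rewrite ?tvK.
  by move=> /(twists_cube k' e'); rewrite fK.
Qed.

(** The factor t (1 - t) vanishes at both ends, so that the end map does not
    depend on K. *)
Definition isotopy (K E : nat -> R) (t : R) : 'rV[R]_n -> 'rV[R]_n :=
  twists c r (fun j => K j * (t * (1 - t))) (fun j => E j * t).

Lemma isotopy_smooth K E : smooth_isotopy (isotopy K E).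
Proof.
split.
- by move=> t _; exact: SDiff_twists.
- move=> x _; rewrite /isotopy; case: (some_ballP c r x) => [j Bj|nB].
    rewrite (twists_in disjoint_balls _ _ Bj)// mul0r !mulr0; exact: twist0.
  exact: (twists_notin r_gt0).
pose tm (z : 'rV[R]_(1 + n)) := (lsubmx z : 'rV[R]_1) 0 0.
have etm : elementary tm.
  rewrite /tm (_ : (fun z => _) = fun z : 'rV[R]_(1 + n) => z 0 (lshift n 0)).
    exact: elementary_coord.
  by apply/funext => z; rewrite mxE.
apply: (@twists_smooth _ _ (fun j z => K j * (tm z * (1 - tm z)))
  (fun j z => E j * tm z) (fun z => rsubmx z)).
- move=> j; apply: elementaryM; first exact: elementary_cst.
  by apply: elementaryM => //; apply: elementaryB => //; exact: elementary_cst.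
- by move=> j; apply: elementaryM => //; exact: elementary_cst.
- move=> i; rewrite (_ : (fun z => _) = fun z : 'rV[R]_(1 + n) => z 0 (rshift 1 i)).
    exact: elementary_coord.
  by apply/funext => z; rewrite mxE.
- by move=> z [].
Qed.

End FamilyInCube.

(** * Velocity *)

Section Velocity.
Context {R : realType}.

(** The integral of a nonnegative function is a supremum over the simple
    functions below it, and a larger function on a larger domain has more of
    them. *)
Lemma ge0_le_integral_subset d (T : measurableType d)
    (mu : {measure set T -> \bar R}) (D D' : set T) (f g : T -> \bar R) :
  (forall x, D x -> 0 <= f x)%E -> (forall x, D' x -> 0 <= g x)%E ->
  D `<=` D' -> (forall x, D x -> f x <= g x)%E ->
  (\int[mu]_(x in D) f x <= \int[mu]_(x in D') g x)%E.
Proof.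
move=> f0 g0 DD' fg; rewrite !ge0_integralE//.
apply: le_ereal_sup => _ [h /= hf <-]; exists h => //= x.
apply: (le_trans (hf x)); rewrite /patch; case: ifPn => [|_].
  by rewrite inE => Dx; rewrite mem_set ?fg//; exact: DD'.
by case: ifPn => // /set_mem; exact: g0.
Qed.

Lemma proper_within01 (t : R) : 0 <= t <= 1 ->
  ProperFilter (within `[0, 1]%classic t^').
Proof.
move=> t01; apply: Build_ProperFilter_ex => A.
rewrite /within /dnbhs /= => /nbhs_ballP[e /= e0 He].
pose d := Num.min (e / 2) 4^-1.
have d0 : 0 < d by rewrite lt_min; apply/andP; split; lra.
have de : d < e by rewrite gt_min; apply/orP; left; lra.
have d4 : d <= 4^-1 by rewrite ge_min lexx orbT.
have [t2|t2] := leP t 2^-1.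
  exists (t + d); apply: He => /=.
  - by rewrite /ball/= opprD addrA subrr add0r normrN gtr0_norm.
  - by apply/eqP; lra.
  - by rewrite in_itv/=; lra.
exists (t - d); apply: He => /=.
- by rewrite /ball/= opprB addrC subrK gtr0_norm.
- by apply/eqP; lra.
- by rewrite in_itv/=; lra.
Qed.

Lemma velocity_derive n (xi : R -> 'rV[R]_n -> 'rV[R]_n) (t : R) x l :
  0 <= t <= 1 -> is_derive t (1 : R) (fun s => xi s x) l ->
  velocity xi t x = l.
Proof.
move=> t01 [dxi dl]; have PF := proper_within01 t01.
apply: cvg_lim => //; apply/(@cvgrPdist_le _ _ _ _ _) => e e0.
have := dxi; rewrite /derivable => cv.
have {cv} : (fun h => h^-1 *: (((fun s => xi s x) \o shift t) (h *: 1) - xi t x))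
  @ 0^' --> l by rewrite -dl; exact: cv.
move=> /cvgrPdist_le/(_ e e0); rewrite /within /dnbhs/= => /nbhs_ballP[d /= d0 Hd].
apply/nbhs_ballP; exists d => // s /= std st _.
have := Hd (s - t); rewrite /= [(s - t) *: 1]mulr1 subrK; apply.
  by move: std; rewrite /ball/= sub0r opprB.
by rewrite subr_eq0.
Qed.

Lemma is_derive_trig_comp (w p q : R) (a : R -> R) (a' t : R) :
  is_derive t (1 : R) a a' ->
  is_derive t (1 : R) (fun s => w + (p * cos (a s) + q * sin (a s)))
    (a' * (q * cos (a t) - p * sin (a t))).
Proof.
move=> da.
have dc : is_derive t (1 : R) (cos \o a) (- sin (a t) * a') by exact: is_derive1_comp.
have ds : is_derive t (1 : R) (sin \o a) (cos (a t) * a') by exact: is_derive1_comp.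
apply: (is_derive_eq (is_deriveD (is_derive_cst w t 1)
  (is_deriveD (is_deriveZ p dc) (is_deriveZ q ds)))).
rewrite add0r /GRing.scale/=; ring.
Qed.

Context {m : nat}.
Notation n := m.+2.
Notation i0 := (ord0 : 'I_n).
Notation i1 := (lift ord0 ord0 : 'I_n).
Implicit Types (c x y : 'rV[R]_n).

(** The infinitesimal generator of the rotations about c. *)
Definition perp c x : 'rV[R]_n := \row_j
  if j == i0 then - (x 0 i1 - c 0 i1)
  else if j == i1 then x 0 i0 - c 0 i0 else 0.

Definition planar c x : R := (x 0 i0 - c 0 i0) ^+ 2 + (x 0 i1 - c 0 i1) ^+ 2.

Lemma planar_rotation c a x : planar c (rotation c a x) = planar c x.
Proof.
rewrite /planar rotE0 rotE1; set u := x 0 i0 - _; set v := x 0 i1 - _.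
have := cos2Dsin2 a; set p := cos a; set q := sin a => pq.
transitivity ((p ^+ 2 + q ^+ 2) * (u ^+ 2 + v ^+ 2)); first by ring.
by rewrite pq mul1r.
Qed.

Lemma enorm_perp c x (b : R) : enorm (b *: perp c x) ^+ 2 = b ^+ 2 * planar c x.
Proof.
rewrite /enorm sqr_sqrtr; last by apply: sumr_ge0 => i _; rewrite -expr2 sqr_ge0.
rewrite /dotv !big_ord_recl/= big1 => [|j _]; last by rewrite !mxE /= mulr0 mul0r.
by rewrite !mxE /= /planar; ring.
Qed.

Lemma is_derive_rotation c x (a : R -> R) (a' t : R) :
  is_derive t (1 : R) a a' ->
  is_derive t (1 : R) (fun s => rotation c (a s) x)
    (a' *: perp c (rotation c (a t) x)).
Proof.
move=> da; set l := _ *: _.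
have dj j : is_derive t (1 : R) (fun s => rotation c (a s) x 0 j) (l 0 j).
  set u := x 0 i0 - c 0 i0; set v := x 0 i1 - c 0 i1.
  have [->|n0] := eqVneq j i0.
    have E s : rotation c (a s) x 0 i0 =
        c 0 i0 + (u * cos (a s) + - v * sin (a s)) by rewrite rotE0 -/u -/v; ring.
    rewrite (funext E).
    apply: (is_derive_eq (is_derive_trig_comp (c 0 i0) u (- v) da)).
    by rewrite !mxE /= -/u -/v; ring.
  have [->|n1] := eqVneq j i1.
    have E s : rotation c (a s) x 0 i1 =
        c 0 i1 + (v * cos (a s) + u * sin (a s)) by rewrite rotE1 -/u -/v; ring.
    rewrite (funext E).
    apply: (is_derive_eq (is_derive_trig_comp (c 0 i1) v u da)).
    by rewrite !mxE /= -/u -/v; ring.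
  have E s : rotation c (a s) x 0 j = x 0 j.
    by rewrite mxE (negbTE n0) (negbTE n1).
  rewrite (funext E) (_ : l 0 j = 0); first exact: is_derive_cst.
  by rewrite 2!mxE (negbTE n0) (negbTE n1) mulr0.
have dr : derivable (fun s => rotation c (a s) x) t 1.
  by apply/derivable_mxP => i j; rewrite (ord1 i); have [] := dj j.
apply: DeriveDef => //; apply/rowP => j.
by rewrite derive_mx// mxE; have [_ ->] := dj j.
Qed.

End Velocity.

(** * Action *)

Section SpeedIntegral.
Context {R : realType}.

Definition speed_integral n (v : 'rV[R]_n -> 'rV[R]_n) : \bar R :=
  (\int[@lebesgue R n]_(x in [set x | (@cube R n)^° (rv x)])
     ((enorm (v (rv x))) ^+ 2)%:E)%E.

Lemma speed_integralE n (v : 'rV[R]_n -> 'rV[R]_n) : speed_integral v =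
  (\int[lebm n]_(x in [set x | (@cube R n)^° (rv x)])
     ((enorm (v (rv x))) ^+ 2)%:E)%E.
Proof. by rewrite /speed_integral lebmE. Qed.

Lemma speed_integral_ge0 n (v : 'rV[R]_n -> 'rV[R]_n) : (0 <= speed_integral v)%E.
Proof.
rewrite speed_integralE; apply: integral_ge0 => x _.
by rewrite lee_fin sqr_ge0.
Qed.

Lemma actionE n (xi : R -> 'rV[R]_n -> 'rV[R]_n) : action xi =
  ((2^-1)%:E * \int[@lebesgue_measure R]_(t in `[0%R, 1%R])
     speed_integral (velocity xi t))%E.
Proof. by []. Qed.

End SpeedIntegral.

Section Action.
Context {R : realType} {m : nat}.
Notation n := m.+2.
Notation i0 := (ord0 : 'I_n).
Notation i1 := (lift ord0 ord0 : 'I_n).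
Variables (c : nat -> 'rV[R]_n) (r : nat -> R).
Hypothesis r_gt0 : forall j, 0 < r j.
Hypothesis disjoint_balls : trivIset [set: nat] (fun j => eball (c j) (r j)).
Implicit Types (x y : 'rV[R]_n) (j : nat) (K E : nat -> R).

Let B j : set 'rV[R]_n := eball (c j) (r j).

Hypothesis balls_cube : forall j, B j `<=` @cube R n.

Definition angular_speed j (k e t : R) x : R :=
  k * (1 - 2 * t) * fast c r j x + e * slow c r j x.

Lemma isotopy_in K E t j x : B j x -> isotopy c r K E t x =
  rotation (c j) (angle c r j (K j * (t * (1 - t))) (E j * t) x) x.
Proof. by move=> Bx; rewrite /isotopy (twists_in disjoint_balls _ _ Bx). Qed.

Lemma velocity_isotopy K E t j x : 0 <= t <= 1 -> B j x ->
  velocity (isotopy c r K E) t x =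
  angular_speed j (K j) (E j) t x *: perp (c j) (isotopy c r K E t x).
Proof.
move=> t01 Bx; apply: velocity_derive => //.
rewrite (funext (fun s => isotopy_in K E s Bx)) (isotopy_in K E t Bx).
apply: (@is_derive_rotation _ _ _ _
  (fun s => angle c r j (K j * (s * (1 - s))) (E j * s) x)).
rewrite /angle /angular_speed.
set F := fast _ _ _ _; set G := slow _ _ _ _.
pose p : {poly R} := (K j * F)%:P * ('X - 'X^2) + (E j * G)%:P * 'X.
have pE s : K j * (s * (1 - s)) * F + E j * s * G = p.[s].
  by rewrite /p !(hornerD, hornerN, hornerM, hornerC, hornerX, hornerXn); ring.
rewrite (funext pE); apply: (is_derive_eq (is_derive_poly p t)).
rewrite /p !(derivD, derivM, derivN, derivC, derivX, derivXn).
by rewrite !(hornerD, hornerN, hornerM, hornerC, hornerX, hornerXn, hornerMn); ring.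
Qed.

Lemma speed_isotopy K E t j x : 0 <= t <= 1 -> B j x ->
  enorm (velocity (isotopy c r K E) t x) ^+ 2 =
  angular_speed j (K j) (E j) t x ^+ 2 * planar (c j) x.
Proof.
move=> t01 Bx; rewrite (velocity_isotopy K E t01 Bx) enorm_perp.
by rewrite (isotopy_in K E t Bx) planar_rotation.
Qed.

Lemma velocity_out K E t x : 0 <= t <= 1 -> (forall j, ~ B j x) ->
  velocity (isotopy c r K E) t x = 0.
Proof.
move=> t01 nB; apply: velocity_derive => //.
rewrite (_ : (fun s => _) = cst x); first exact: is_derive_cst.
by apply/funext => s; rewrite /isotopy (twists_notin r_gt0).
Qed.

Lemma planar_le_sqdist x y : planar x y <= sqdist x y.
Proof.
rewrite /planar /sqdist !big_ord_recl/= addrA lerDl.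
by apply: sumr_ge0 => i _; exact: sqr_ge0.
Qed.

(** The bound on E makes all speeds at most 1; the cube lies in a box of finite
    measure. *)
Lemma action_finite E : (forall j, 0 <= E j <= (1 + r j)^-1) ->
  (action (isotopy c r (fun=> 0%R) E) < +oo)%E.
Proof.
move=> HE; rewrite actionE.
set inner := fun t : R => speed_integral _.
pose M : R := \prod_(i < n) (2 - -1).
have inner_le t : 0 <= t <= 1 -> (0 <= inner t <= M%:E)%E.
  move=> t01.
  have h12 (i : 'I_n) : -1 <= 2 :> R by lra.
  have [mB lB] := @lebesgue_box R n (fun=> -1) (fun=> 2) h12; clear h12.
  rewrite /inner speed_integral_ge0 speed_integralE /=.
  rewrite -lB -[X in (_ <= X)%E]mul1e -lebmE -integral_cst//.
  apply: ge0_le_integral_subset => [x _|x _|x /interior_subset Cx i|x _].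
  - by rewrite lee_fin sqr_ge0.
  - by [].
  - by have := Cx i; rewrite mxE => /andP[h1 h2]; apply/andP; split; lra.
  rewrite lee_fin; case: (some_ballP c r (rv x)) => [j Bj|nB]; last first.
    rewrite velocity_out// /enorm /dotv big1 => [|i _]; last by rewrite mxE mul0r.
    by rewrite sqrtr0 expr0n ler01.
  rewrite (speed_isotopy _ _ t01 Bj) /angular_speed mul0r mul0r add0r exprMn.
  have /andP[E0 E1] := HE j; have rj := r_gt0 j.
  apply: (@le_trans _ _ ((1 + r j) ^- 2 * 1 * r j ^+ 2)).
    apply: ler_pM.
    - by rewrite mulr_ge0// sqr_ge0.
    - by rewrite addr_ge0// sqr_ge0.
    - apply: ler_pM; rewrite ?sqr_ge0//.
        by rewrite -exprVn lerXn2r ?nnegrE// invr_ge0; lra.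
      by rewrite expr_le1// ?bump_ge0 ?bump_le1.
    apply: (le_trans (planar_le_sqdist _ _)); apply: ltW.
    exact: (eballE (c j) (rv x) rj).1 Bj.
  have h : 0 < 1 + r j by lra.
  rewrite mulr1 mulrC ler_pdivrMr ?exprn_gt0// mul1r.
  by rewrite lerXn2r ?nnegrE; lra.
have le1 : (\int[@lebesgue_measure R]_(t in `[0%R, 1%R]) inner t <= M%:E)%E.
  rewrite -[X in (_ <= X)%E](_ : M%:E * @lebesgue_measure R `[0%R, 1%R] = _)%E.
    rewrite -integral_cst//; apply: ge0_le_integral_subset => // t.
    + by rewrite /= in_itv/= => /inner_le/andP[].
    + by rewrite /= in_itv/= => /inner_le/andP[h1 h2]; exact: le_trans h1 h2.
    + by rewrite /= in_itv/= => /inner_le/andP[].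
  by rewrite lebesgue_measure_itv/= lte_fin ltr01 oppr0 addr0 mule1.
apply: (@le_lt_trans _ _ ((2^-1)%:E * M%:E)%E); last exact: ltry.
by rewrite lee_pmul2l.
Qed.

(** The inner part of the j-th ball moves with speed at least a multiple of k
    on a small box, as long as t stays away from 1/2, where the oscillation
    turns round. *)
Lemma action_large j : exists k, forall K E t, K j = k -> 0 <= t <= 4^-1 ->
  (j%:R%:E <= speed_integral (velocity (isotopy c r K E) t))%E.
Proof.
have rj := r_gt0 j.
pose q : 'rV[R]_n := \row_i (if i == i0 then c j 0 i0 + r j / 2 else c j 0 i).
pose phi x := fast c r j x * fast c r j x * planar (c j) x.
have ephi : elementary phi.
  have es i : elementary (fun x : 'rV[R]_n => (x 0 i - c j 0 i) ^+ 2).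
    rewrite (_ : (fun x => _) = fun x : 'rV[R]_n =>
      (x 0 i - c j 0 i) * (x 0 i - c j 0 i)).
      by apply: elementaryM; apply: elementaryB;
        [exact: elementary_coord|exact: elementary_cst
        |exact: elementary_coord|exact: elementary_cst].
    by apply/funext => x; rewrite expr2.
  apply: elementaryM; first by apply: elementaryM; exact: elementary_fast.
  exact: (elementaryD (es i0) (es i1)).
have q0 : q 0 i0 - c j 0 i0 = r j / 2 by rewrite mxE eqxx addrC addKr.
have q1 i : i != i0 -> q 0 i - c j 0 i = 0.
  by move=> /negbTE i_0; rewrite mxE i_0 subrr.
have relq : reldist c r j q = 4^-1.
  rewrite /reldist /sqdist big_ord_recl/= big1 => [|i _]; last first.
    by rewrite q1// expr0n.
  by rewrite q0; field; rewrite gt_eqF.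
have plq : planar (c j) q = r j ^+ 2 / 4.
  by rewrite /planar q0 q1//; field.
have phiq : 0 < phi q.
  have fq : 0 < fast c r j q by rewrite bump_gt0// relq; lra.
  have r2 : 0 < r j ^+ 2 / 4 by rewrite divr_gt0 ?exprn_gt0.
  by rewrite /phi plq; exact: mulr_gt0 (mulr_gt0 fq fq) r2.
have near_q : \forall x \near q, phi q / 2 < phi x /\ reldist c r j x < 2^-1.
  apply: filterI.
    have h : phi q / 2 < phi q by lra.
    exact: (elementary_continuous ephi (lt_nbhsr h)).
  have h : reldist c r j q < 2^-1 by rewrite relq; lra.
  exact: (elementary_continuous (elementary_reldist c r j) (lt_nbhsl h)).
have [d /= d0 Hd] := (nbhs_ballP _ _).1 near_q.
have dle i : q 0 i - d <= q 0 i + d by lra.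
have [mB lB] := lebesgue_box dle.
set A := (mkset _) in mB lB; set V := (\prod_i _) in lB.
have V0 : 0 < V by apply: prodr_gt0 => i _; lra.
have AP t : A t -> phi q / 2 < phi (rv t) /\ reldist c r j (rv t) < 2^-1.
  move=> At; apply: Hd; split=> // i i'; rewrite /ball/= (ord1 i) [rv t _ _]mxE.
  by have /andP[h1 h2] := At i'; rewrite ltr_norml; apply/andP; split; lra.
pose w := phi q / 8 * V.
have w0 : 0 < w by rewrite mulr_gt0// divr_gt0.
exists (1 + j%:R / w) => K E t Kj t01; set k := 1 + _ in Kj.
have k1 : 1 <= k by rewrite lerDl divr_ge0 ?ler0n// ltW.
have t01' : 0 <= t <= 1 by lra.
rewrite speed_integralE.
apply: (@le_trans _ _ (\int[lebm n]_(x in A) (k ^+ 2 * (phi q / 8))%:E)%E).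
  have lbA : lebm n A = V%:E by rewrite -lB -lebmE.
  rewrite integral_cst//= lbA -EFinM lee_fin -mulrA -/w.
  rewrite -ler_pdivrMr//; apply: (@le_trans _ _ k); first by rewrite lerDr.
  by rewrite expr2 ler_peMl//; lra.
have in_ball (x : n.-tuple R) : A x -> B j (rv x).
  by move=> /AP[_ h]; apply/(reldist_lt1 c r_gt0); lra.
apply: ge0_le_integral_subset => [x _|x _|x Ax|x Ax].
- by rewrite lee_fin mulr_ge0 ?sqr_ge0//; lra.
- by rewrite lee_fin sqr_ge0.
- exact: (ball_interior r_gt0 balls_cube (in_ball _ Ax)).
have [h1 h2] := AP _ Ax.
rewrite lee_fin (speed_isotopy K E t01' (in_ball _ Ax)) /angular_speed Kj.
have -> : slow c r j (rv x) = 0 by rewrite /slow bump0l// ltW.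
rewrite mulr0 addr0 [X in _ <= X](_ : _ =
  k ^+ 2 * ((1 - 2 * t) ^+ 2 * phi (rv x))); last by rewrite /phi; ring.
rewrite ler_wpM2l ?sqr_ge0//.
apply: (@le_trans _ _ (4^-1 * phi (rv x))); first by lra.
rewrite ler_wpM2r//; first by lra.
by nra.
Qed.

End Action.

(** The two isotopies, for any suitable family of balls. The outer shell of each
    ball is a clock: it turns at a constant small rate. *)
Lemma twisting_balls (R : realType) (m : nat) (c : nat -> 'rV[R]_m.+2)
    (r : nat -> R) :
  (forall j, 0 < r j) ->
  trivIset [set: nat] (fun j => eball (c j) (r j)) ->
  r j @[j --> \oo] --> 0 ->
  (forall j, eball (c j) (r j) `<=` @cube R m.+2) ->
  (forall y, (@cube R m.+2)^° y -> exists2 U, nbhs y U &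
     finite_set [set j | eball (c j) (r j) `&` U !=set0]) ->
  exists xi eta : R -> 'rV[R]_m.+2 -> 'rV[R]_m.+2,
    [/\ infinite_finite_pair xi eta,
        supported_on xi (\bigcup_j eball (c j) (r j)) &
        forall j,
          (forall t, 0 <= t <= 1 ->
             exists2 y, eball (c j) (r j) y & velocity xi t y <> 0) /\
          (forall s t, 0 <= s -> s < t -> t <= 1 ->
             exists2 y, eball (c j) (r j) y & xi s y <> xi t y)].
Proof.
move=> r_gt0 dis r_cvg0 sub lf.
have [K HK] := choice (action_large r_gt0 dis sub).
pose E j := (1 + r j)^-1.
have E0 j : 0 < E j by rewrite invr_gt0 addr_gt0.
have E1 j : E j <= 1 by rewrite invf_le1 ?lerDl ?addr_gt0// ltW.
exists (isotopy c r K E), (isotopy c r (fun=> 0) E).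
pose p j : 'rV[R]_m.+2 :=
  \row_i (if i == ord0 then c j 0 ord0 + r j * (3 / 4) else c j 0 i).
have p0 j : p j 0 ord0 - c j 0 ord0 = r j * (3 / 4).
  by rewrite mxE eqxx addrC addKr.
have p1 j i : i != ord0 -> p j 0 i - c j 0 i = 0.
  by move=> /negbTE i_0; rewrite mxE i_0 subrr.
have relp j : reldist c r j (p j) = 9 / 16.
  rewrite /reldist /sqdist big_ord_recl/= big1 => [|i _]; last first.
    by rewrite p1// expr0n.
  by rewrite p0; field; rewrite gt_eqF.
have Bp j : eball (c j) (r j) (p j).
  by apply/(reldist_lt1 c r_gt0); rewrite relp; lra.
have fastp j : fast c r j (p j) = 0 by rewrite /fast bump0r// relp; lra.
have slowp j : 0 < slow c r j (p j) <= 1.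
  by rewrite /slow bump_le1 bump_gt0// relp; lra.
split.
- split.
  + exact: isotopy_smooth.
  + exact: isotopy_smooth.
  + move=> x _; rewrite /isotopy; congr (twists c r _ _ x).
    by apply/funext => j; rewrite subrr !mulr0.
  + have inf t : 0 <= t <= 4^-1 ->
        speed_integral (velocity (isotopy c r K E) t) = +oo%E.
      move=> t01; apply/eqyP => A A0.
      apply: (le_trans _ (HK (Num.bound A) K E t erefl t01)).
      by rewrite lee_fin ltW// archi_boundP// ltW.
    rewrite actionE [X in (_ * X)%E](_ : _ = +oo%E); first by rewrite gt0_muley.
    apply/eqyP => A A0.
    apply: (@le_trans _ _
        (\int[@lebesgue_measure R]_(t in `[0%R, 4^-1%R]) (4 * A)%:E)%E).
      rewrite integral_cst//= lebesgue_measure_itv/= lte_fin invr_gt0 ltr0n.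
      by rewrite sube0 -EFinM lee_fin; lra.
    apply: ge0_le_integral_subset => t.
    * by move=> _; rewrite lee_fin mulr_ge0// ltW.
    * by move=> _; exact: speed_integral_ge0.
    * by rewrite /= !in_itv/=; lra.
    * by rewrite /= in_itv/= => /inf ->; rewrite leey.
  + apply: action_finite => // j.
    by rewrite lexx andbT ltW.
- move=> t x _ _ nB; rewrite /isotopy twists_notin// => j Bj.
  by apply: nB; exists j.
- move=> j; split=> [t t01|s t s0 st t1].
    (* The point p j lies in the shell where only the clock acts. *)
    exists (p j) => // v0.
    have := speed_isotopy dis K E t01 (Bp j).
    rewrite v0 /angular_speed fastp mulr0 add0r.
    rewrite /enorm /dotv big1 => [|i _]; last by rewrite mxE mul0r.
    rewrite sqrtr0 expr0n/= => /esym/eqP; apply/negP.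
    have /andP[sl0 _] := slowp j.
    have pl : 0 < planar (c j) (p j).
      by rewrite /planar p0 p1// expr0n addr0 exprn_gt0// mulr_gt0.
    by rewrite gt_eqF// (mulr_gt0 (exprn_gt0 2 (mulr_gt0 (E0 j) sl0)) pl).
  exists (p j) => // /(congr1 (fun v : 'rV[R]__ => v 0 (lift ord0 ord0))).
  have /andP[sl0 sl1] := slowp j.
  rewrite !(isotopy_in dis _ _ _ (Bp j)) !rotE1 p0 p1// !mulr0 !addr0.
  move=> /addrI /mulIf; rewrite mulf_neq0 ?gt_eqF// => /(_ isT).
  rewrite /angle fastp !mulr0 !add0r.
  have h u : 0 <= u <= 1 -> E j * u * slow c r j (p j) \in `[(- (pi / 2)), (pi / 2)].
    move=> /andP[u0 u1]; rewrite in_itv/=; have pi1 := @pihalf_ge1 R.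
    have Eu0 : 0 <= E j * u := mulr_ge0 (ltW (E0 j)) u0.
    have Eu1 : E j * u <= 1 := mulr_ile1 (ltW (E0 j)) u0 (E1 j) u1.
    have b0 := mulr_ge0 Eu0 (ltW sl0).
    have b1 := mulr_ile1 Eu0 (ltW sl0) Eu1 sl1.
    by apply/andP; split; lra.
  move=> /(@sin_inj R _ _ (h s ltac:(lra)) (h t ltac:(lra))).
  move/mulIf; rewrite gt_eqF// => /(_ isT)/mulfI; rewrite gt_eqF//.
  by move=> /(_ isT) ?; lra.
Qed.

(** * Derivatives within a set *)

Section DerivativeWithin.
Context {R : realType}.

Definition derivative_within m k (A : set 'rV[R]_m) (f : 'rV[R]_m -> 'rV[R]_k)
    (x : 'rV[R]_m) (L : 'M[R]_(m, k)) : Prop :=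
  forall e : R, 0 < e -> \forall y \near within A (nbhs x),
    `|f y - f x - (y - x) *m L| <= e * `|y - x|.

Lemma jacobian_within_ex m k (A : set 'rV[R]_m) (f : 'rV[R]_m -> 'rV[R]_k) x L :
  derivative_within A f x L ->
  derivative_within A f x (jacobian_within A f x).
Proof. by move=> h; rewrite /jacobian_within; apply: xgetPex; exists L. Qed.

(** The value 0 is the default when there is no derivative. *)
Lemma jacobian_within_neq0 m k (A : set 'rV[R]_m) (f : 'rV[R]_m -> 'rV[R]_k) x :
  jacobian_within A f x != 0 ->
  derivative_within A f x (jacobian_within A f x).
Proof. by rewrite {1}/jacobian_within; case: xgetP => [L _ + _|_]; rewrite ?eqxx. Qed.

Lemma derivative_within_affine m k (A : set 'rV[R]_m) (f : 'rV[R]_m -> 'rV[R]_k)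
    x L (a : R) (b : 'rV[R]_k) : a != 0 -> derivative_within A f x L ->
  derivative_within A (fun y => a *: f y + b) x (a *: L).
Proof.
move=> a0 df e e0; have a0' : 0 < `|a| by rewrite normr_gt0.
have := df (e / `|a|) (divr_gt0 e0 a0'); apply: filterS => y h.
rewrite opprD addrACA subrr addr0 -scalerBr -scalemxAr -scalerBr normrZ.
by rewrite -ler_pdivlMl// mulrA (mulrC _^-1).
Qed.

Lemma cvg_sumr (T : Type) (F : set_system T) (FF : Filter F) I (s : seq I)
    (f : I -> T -> R) (l : I -> R) : (forall i, f i x @[x --> F] --> l i) ->
  \sum_(i <- s) f i x @[x --> F] --> \sum_(i <- s) l i.
Proof.
move=> fl; elim: s => [|i s IH].
  under eq_fun do rewrite big_nil; rewrite big_nil; exact: cvg_cst.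
under eq_fun do rewrite big_cons; rewrite big_cons; exact: cvgD.
Qed.

Lemma cvg_coord (T : Type) (F : set_system T) (FF : Filter F) m
    (f : T -> 'rV[R]_m) (l : 'rV[R]_m) i : f x @[x --> F] --> l ->
  f x 0 i @[x --> F] --> l 0 i.
Proof. by move=> fl; exact: (cvg_comp _ _ fl (@coord_continuous R 1 m 0 i l)). Qed.

Lemma cvg_mulmxr (T : Type) (F : set_system T) (FF : Filter F) m k
    (f : T -> 'rV[R]_m) (l : 'rV[R]_m) (L : 'M[R]_(m, k)) :
  f x @[x --> F] --> l -> f x *m L @[x --> F] --> l *m L.
Proof.
move=> fl; apply: cvg_rowP => i; rewrite mxE.
under eq_fun do rewrite mxE.
apply: cvg_sumr => j; apply: cvgM; last exact: cvg_cst.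
exact: cvg_coord.
Qed.

(** Only the difference quotients of the curve s at 0 matter, so the lemma can
    be applied again to the image curve. *)
Lemma derivative_along_curve m k (A : set 'rV[R]_m) (f : 'rV[R]_m -> 'rV[R]_k)
    x L (s : R -> 'rV[R]_m) (w : 'rV[R]_m) :
  derivative_within A f x L -> s 0 = x -> (\forall h \near 0^', A (s h)) ->
  h^-1 *: (s h - x) @[h --> (0 : R)^'] --> w ->
  h^-1 *: (f (s h) - f x) @[h --> (0 : R)^'] --> w *m L.
Proof.
move=> df s0 As sw.
have sx : s h @[h --> (0 : R)^'] --> x.
  rewrite -[X in _ --> X]addr0 -(scale0r w).
  have : x + h *: (h^-1 *: (s h - x)) @[h --> (0 : R)^'] --> x + 0 *: w.
    apply: cvgD; first exact: cvg_cst.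
    apply: cvgZ => //; apply: cvg_within_filter; exact: cvg_id.
  apply: cvg_trans; apply: near_eq_cvg; near=> h.
  rewrite scalerA divff ?scale1r ?subrKC//.
  by near: h; exact: nbhs_dnbhs_neq.
have rem : h^-1 *: (f (s h) - f x - (s h - x) *m L) @[h --> (0 : R)^'] --> 
    (0 : 'rV[R]_k).
  apply/cvgr0Pnorm_le => e e0.
  pose N := `|w| + 1; have N0 : 0 < N by rewrite ltr_wpDl.
  have QN : \forall h \near 0^', `|h^-1 *: (s h - x)| <= N.
    move: (sw) => /cvgrPdist_le/(_ 1 ltr01); apply: filterS => h hw.
    rewrite -(subrK w (h^-1 *: _)) addrC; apply: (le_trans (ler_normD _ _)).
    by rewrite lerD2l distrC.
  have Ah : \forall h \near 0^', `|f (s h) - f x - (s h - x) *m L|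
      <= (e / N) * `|s h - x|.
    have := sx _ (df (e / N) (divr_gt0 e0 N0)).
    by rewrite /= nearE; apply: filterS2 As => h Ash; apply.
  near=> h.
  have h0 : h != 0 by near: h; exact: nbhs_dnbhs_neq.
  have h1 : `|h^-1 *: (s h - x)| <= N by near: h.
  have h2 : `|f (s h) - f x - (s h - x) *m L| <= (e / N) * `|s h - x| by near: h.
  rewrite normrZ; apply: (@le_trans _ _ (`|h^-1| * ((e / N) * `|s h - x|))).
    by rewrite ler_wpM2l.
  rewrite mulrCA -normrZ mulrAC ler_pdivrMr//.
  by rewrite ler_wpM2l// ltW.
have : h^-1 *: (f (s h) - f x - (s h - x) *m L) + h^-1 *: (s h - x) *m L
    @[h --> (0 : R)^'] --> 0 + w *m L by apply: cvgD => //; exact: cvg_mulmxr.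
rewrite add0r; apply: cvg_trans; apply: near_eq_cvg; near=> h.
by rewrite -scalemxAl -scalerDr subrK.
Unshelve. all: by end_near. Qed.

(** The difference of squared distances is h psi(h), where psi tends to
    2 dotv (g 0 - y) v; as it is nonnegative for both signs of h, the limit
    vanishes. *)
Lemma nearest_orthogonal n (g : R -> 'rV[R]_n) (y v : 'rV[R]_n) :
  h^-1 *: (g h - g 0) @[h --> (0 : R)^'] --> v ->
  (forall h, dotv (g 0 - y) (g 0 - y) <= dotv (g h - y) (g h - y)) ->
  dotv (g 0 - y) v = 0.
Proof.
move=> gv gmin; set nu := g 0 - y.
pose Q h := h^-1 *: (g h - g 0).
pose psi h := \sum_i Q h 0 i * (2 * nu 0 i + h * Q h 0 i).
have psiE h : h != 0 ->
    dotv (g h - y) (g h - y) - dotv nu nu = h * psi h.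
  move=> h0; rewrite /dotv /psi -sumrB mulr_sumr; apply: eq_bigr => i _.
  have -> : (g h - y) 0 i = nu 0 i + h * Q h 0 i.
    rewrite /Q /nu !mxE mulrA divff// mul1r; ring.
  ring.
have psi_cvg : psi h @[h --> (0 : R)^'] --> 2 * dotv nu v.
  rewrite (_ : 2 * _ = \sum_i v 0 i * (2 * nu 0 i + 0 * v 0 i)); last first.
    by rewrite /dotv mulr_sumr; apply: eq_bigr => i _; ring.
  apply: cvg_sumr => i.
  have cQ : Q h 0 i @[h --> (0 : R)^'] --> v 0 i by exact: cvg_coord.
  apply: cvgM => //; apply: cvgD; first exact: cvg_cst.
  by apply: cvgM => //; apply: cvg_within_filter; exact: cvg_id.
have sgn h : h != 0 -> 0 <= h * psi h.
  by move=> h0; rewrite -psiE// subr_ge0.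
have [lt0|gt0|//] := ltgtP (dotv nu v) 0; exfalso.
- have : \forall h \near 0^', psi h < 0.
    by apply: (cvgr_lt _ psi_cvg); lra.
  rewrite /dnbhs /within/= => /nbhs_ballP[d /= d0 Hd].
  have h0 : d / 2 != 0 by rewrite gt_eqF// divr_gt0.
  have h1 : psi (d / 2) < 0.
    by apply: Hd => //; rewrite /ball/= sub0r normrN gtr0_norm; lra.
  by have := sgn _ h0; rewrite pmulr_rge0 ?divr_gt0// leNgt h1.
- have : \forall h \near 0^', 0 < psi h.
    by apply: (cvgr_gt _ psi_cvg); lra.
  rewrite /dnbhs /within/= => /nbhs_ballP[d /= d0 Hd].
  have h0 : - (d / 2) != 0 by rewrite oppr_eq0 gt_eqF// divr_gt0.
  have h1 : 0 < psi (- (d / 2)).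
    by apply: Hd => //; rewrite /ball/= sub0r opprK gtr0_norm; lra.
  have := sgn _ h0; rewrite mulNr oppr_ge0 pmulr_rle0 ?divr_gt0//.
  by rewrite leNgt h1.
Qed.

End DerivativeWithin.

(** * A tubular neighbourhood contains a ball *)

Section Tube.
Context {R : realType} {d : nat} (M : riemannian_manifold R d.+1).

(** The metric is positive definite and transforms by L, so L is injective; in
    particular it is not the default value of a missing derivative. *)
Lemma transition_jacobian c c' p : @atlas _ _ M c -> @atlas _ _ M c' ->
  chart_dom c p -> chart_dom c' p ->
  let L := jacobian_within (transition_dom c c') (transition c c')
             (chart_map c p) in
  derivative_within (transition_dom c c') (transition c c') (chart_map c p) L
  /\ L \in unitmx.
Proof.
move=> ac ac' cp c'p L.
have inj (v : 'rV[R]_d.+1) : v *m L = 0 -> v = 0.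
  move=> vL; apply/eqP/negPn/negP => v0.
  have := metric_pos ac cp v0; rewrite (metric_transition ac ac' cp c'p) -/L.
  by rewrite !mulmxA vL !mul0mx mxE ltxx.
split.
  apply: jacobian_within_neq0; apply/negP => /eqP L0.
  have := inj (delta_mx 0 ord0); rewrite /L L0 mulmx0 => /(_ erefl)/matrixP.
  move=> /(_ 0 ord0); rewrite !mxE !eqxx /= => /eqP; by rewrite oner_eq0.
rewrite -row_free_unit -kermx_eq0; apply/rowV0P => v /sub_kermxP; exact: inj.
Qed.

Lemma transition_dom_nbhs c c' p : @atlas _ _ M c -> @atlas _ _ M c' ->
  chart_dom c p -> chart_dom c' p -> nbhs (chart_map c p) (chart_img c) ->
  nbhs (chart_map c p) (transition_dom c c').
Proof.
move=> ac ac' cp c'p img.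
have [oD _ cK _ cinv] := atlas_chart ac.
have [oD' _ _ _ _] := atlas_chart ac'.
have icp : chart_inv c (chart_map c p) = p by rewrite cK// inE.
have cv := (subspace_continuousP _ _).1 cinv (chart_map c p) (nbhs_singleton img).
have nD' : nbhs (chart_inv c (chart_map c p)) (chart_dom c').
  by rewrite icp; apply: open_nbhs_nbhs.
have := cv _ nD'; rewrite /within/= => H.
apply: filterS2 img H => y [q cq <-] /= h.
have c'q : chart_dom c' q.
  have : chart_dom c' (chart_inv c (chart_map c q)).
    by apply: h; exists q.
  by rewrite cK// inE.
by exists q.
Qed.

Context {n : nat} (f : M -> 'rV[R]_n).
Hypothesis f_derivative : forall c p, @atlas _ _ M c -> chart_dom c p ->
  derivative_within (chart_img c) (f \o chart_inv c) (chart_map c p)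
    (chart_jacobian f c p).

(** A tangent vector read in any chart is the velocity of a curve drawn along a
    straight segment in the chart c, in which p is an interior point; there the
    squared distance to y has a two-sided minimum. *)
Lemma nearest_point_normal c p y : @atlas _ _ M c -> chart_dom c p ->
  nbhs (chart_map c p) (chart_img c) ->
  (forall q, dotv (f p - y) (f p - y) <= dotv (f q - y) (f q - y)) ->
  forall v, tangent_space f p v -> dotv (f p - y) v = 0.
Proof.
move=> ac cp img pmin v [c' [w [ac' c'p ->]]].
have [_ _ cK _ _] := atlas_chart ac.
have [_ _ c'K _ _] := atlas_chart ac'.
have [dL uL] := transition_jacobian ac ac' cp c'p.
set L := jacobian_within _ _ _ in dL uL.
set x := chart_map c p in img dL.
pose u := w *m invmx L.
pose s (h : R) := x + h *: u.
have s0 : s 0 = x by rewrite /s scale0r addr0.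
have s_cont : s h @[h --> (0 : R)^'] --> x.
  rewrite -[X in _ --> X]addr0 -(scale0r u).
  apply: cvgD; first exact: cvg_cst.
  by apply: cvgZ; [apply: cvg_within_filter; exact: cvg_id|exact: cvg_cst].
have s_dom : \forall h \near 0^', transition_dom c c' (s h).
  exact: s_cont (transition_dom_nbhs ac ac' cp c'p img).
have s_quot : h^-1 *: (s h - x) @[h --> (0 : R)^'] --> u.
  have : (fun=> u) h @[h --> (0 : R)^'] --> u by exact: cvg_cst.
  apply: cvg_trans; apply: near_eq_cvg; near=> h.
  rewrite /s addrC addKr scalerA mulVf ?scale1r//.
  by near: h; exact: nbhs_dnbhs_neq.
have tx : transition c c' x = chart_map c' p by rewrite /transition /= cK// inE.
have t_quot := derivative_along_curve dL s0 s_dom s_quot.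
rewrite tx /u mulmxKV// in t_quot.
pose sigma h := transition c c' (s h).
have sigma0 : sigma 0 = chart_map c' p by rewrite /sigma s0.
have sigma_dom : \forall h \near 0^', chart_img c' (sigma h).
  apply: filterS s_dom => h [q [cq c'q] sq].
  by exists q => //; rewrite /sigma /transition /= -sq cK// inE.
have g_quot := derivative_along_curve (f_derivative ac' c'p) sigma0 sigma_dom t_quot.
have g0 : (f \o chart_inv c') (sigma 0) = f p by rewrite /= sigma0 c'K// inE.
have := @nearest_orthogonal _ _ ((f \o chart_inv c') \o sigma) y
  (w *m chart_jacobian f c' p).
rewrite /= sigma0 c'K ?inE//; apply; last by move=> h; exact: pmin.
by move: g_quot; rewrite /= c'K// inE.
Unshelve. all: by end_near. Qed.

(** Push a point of a chart image inwards, off the boundary hyperplane. *)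
Lemma interior_point (q : M) : exists c V (p : M),
  [/\ @atlas _ _ M c, chart_dom c p, open V, chart_img c = V `&` @half_space R d.+1
    & 0 < chart_map c p 0 ord0].
Proof.
have [c ac cq] := atlas_cover q.
have [_ [V oV imgE] _ _ _] := atlas_chart ac.
have [Vq Hq] : (V `&` @half_space R d.+1) (chart_map c q).
  by rewrite -imgE; exists q.
have : nbhs (chart_map c q) V by apply: open_nbhs_nbhs.
move=> /nbhs_ballP[e /= e0 He].
pose x := chart_map c q + (e / 2) *: delta_mx 0 ord0.
have q0 : 0 <= chart_map c q 0 ord0 by exact: Hq.
have x0 : 0 < x 0 ord0 by rewrite !mxE !eqxx /= mulr1; lra.
have : chart_img c x.
  rewrite imgE; split.
    apply: He; split=> // i j; rewrite /ball/= !mxE opprD addrA subrr add0r normrN.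
    case: (_ && _); rewrite ?mulr1 ?mulr0 ?normr0//.
    by rewrite gtr0_norm; lra.
  move=> i i_0; have -> : i = ord0 by exact/val_inj.
  exact: ltW.
by move=> [p cp px]; exists c, V, p; split=> //; rewrite px.
Qed.

End Tube.

(** The embedding keeps the points outside of a neighbourhood of p0 at positive
    distance from f p0; so for y close to f p0 the nearest point of the image is
    still in the interior of the chart. *)
Lemma tube_contains_eball (R : realType) (d m : nat)
    (M : riemannian_manifold R d.+1) (f : M -> 'rV[R]_m.+2) (delta : R) (q : M) :
  compact [set: M] -> continuous f -> injective f ->
  (forall U : set M, open U ->
     exists2 V : set 'rV[R]_m.+2, open V & f @` U = V `&` range f) ->
  (forall c p, atlas c -> chart_dom c p ->
     derivative_within (chart_img c) (f \o chart_inv c) (chart_map c p)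
       (chart_jacobian f c p)) ->
  0 < delta ->
  exists p r, 0 < r /\ eball (f p) r `<=` tube f delta.
Proof.
move=> cM cf inj_f emb df delta0.
have [c [V [p0 [ac cp0 oV imgE pos0]]]] := interior_point q.
have [oD _ _ cmap _] := atlas_chart ac.
have cmap_at p : chart_dom c p -> {for p, continuous (chart_map c)}.
  move=> cp; have := cmap; rewrite continuous_open_subspace// => h.
  by apply: h; rewrite inE.
pose O := [set p | chart_dom c p /\ 0 < chart_map c p 0 ord0].
have oO : open O.
  rewrite openE => p [cp pos]; apply: filterI; first exact: open_nbhs_nbhs.
  have : continuous_at p (fun p => chart_map c p 0 ord0).
    apply: (@continuous_comp _ _ _ (chart_map c)
      (fun x : 'rV[R]_d.+1 => x 0 ord0)); first exact: cmap_at.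
    exact: coord_continuous.
  by move=> /(_ _ (lt_nbhsr pos)).
have [V' oV' fO] := emb O oO.
have V'p0 : V' (f p0).
  have [] : (V' `&` range f) (f p0) by rewrite -fO; exists p0.
  by [].
have : nbhs (f p0) V' by apply: open_nbhs_nbhs.
move=> /nbhs_ballP[e /= e0 He].
exists p0, (Num.min delta (e / 2)); split.
  by rewrite lt_min delta0 divr_gt0.
move=> y yB.
have yd : eball (f p0) delta y.
  by move: yB; rewrite /eball/= lt_min => /andP[].
have ye : eball (f p0) (e / 2) y.
  by move: yB; rewrite /eball/= lt_min => /andP[].
have ccont : continuous (fun p => sqdist y (f p)).
  move=> p; apply: (@continuous_comp _ _ _ f (sqdist y)); first exact: cf.
  exact: (elementary_continuous (elementary_sqdist y)).
have [p _ pmin] := compact_EVT_min (ex_intro _ p0 I) cM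
  (continuous_subspaceT ccont).
have {}pmin z : sqdist y (f p) <= sqdist y (f z) by apply: pmin; rewrite inE.
have sqdistC (a b : 'rV[R]_m.+2) : sqdist a b = sqdist b a.
  by apply: eq_bigr => i _; rewrite -sqrrN opprB.
have close (r : R) : 0 < r -> eball (f p0) r y -> eball y r (f p).
  move=> r0 /(eballE _ _ r0) h; apply/(eballE _ _ r0).
  by apply: le_lt_trans h; rewrite (sqdistC (f p0)).
have V'p : V' (f p).
  apply: He; split=> // i j; rewrite (ord1 i) /ball/=.
  have h1 := eball_coord j ye.
  have h2 := eball_coord j (close _ (divr_gt0 e0 (ltr0Sn _ _)) ye).
  move: h1 h2; rewrite !ltr_norml => /andP[h1 h2] /andP[h3 h4].
  by apply/andP; split; lra.
have [cp pos] : O p.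
  have [p' Op' /inj_f <- //] : (f @` O) (f p) by rewrite fO; split=> //; exists p.
have img : nbhs (chart_map c p) (chart_img c).
  have [Vp _] : (V `&` @half_space R d.+1) (chart_map c p).
    by rewrite -imgE; exists p.
  rewrite imgE; apply: filterI; first exact: open_nbhs_nbhs.
  have pn : nbhs (chart_map c p) [set z : 'rV[R]_d.+1 | 0 < z 0 ord0].
    exact: (@coord_continuous R 1 d.+1 0 ord0 (chart_map c p) _ (lt_nbhsr pos)).
  apply: filterS pn => z z0 i i_0; have -> : i = ord0 by exact/val_inj.
  exact: ltW.
have normal := nearest_point_normal df ac cp img (y := y).
exists (row_mx (f p) (y - f p)).
  exists p; rewrite row_mxKl row_mxKr; split=> // [v tv|].
    rewrite -opprB /dotv; under eq_bigr do rewrite mxE mulNr.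
    rewrite sumrN -/(dotv _ _) normal ?oppr0//.
    by move=> z; rewrite !dotv_sqdist.
  have := close _ delta0 yd.
  by move=> /(eballE _ _ delta0); rewrite sqdistC => /(eballE _ _ delta0).
by rewrite /normal_exp row_mxKl row_mxKr addrC subrK.
Qed.

(** * The theorem *)

(** Dyadic heights make the balls accumulate at a face of the cube only. *)
Lemma disjoint_balls_in_cube (R : realType) (m : nat) :
  exists (c : nat -> 'rV[R]_m.+2) (r : nat -> R),
    [/\ forall j, 0 < r j,
        trivIset [set: nat] (fun j => eball (c j) (r j)),
        r j @[j --> \oo] --> 0,
        forall j, eball (c j) (r j) `<=` @cube R m.+2 &
        forall y, (@cube R m.+2)^° y -> exists2 U, nbhs y U &
          finite_set [set j | eball (c j) (r j) `&` U !=set0]].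
Proof.
pose u j : R := 2^-1 ^+ j.+1.
pose c j : 'rV[R]_m.+2 := \row_i (if i == ord0 then u j else 2^-1).
have u0 j : 0 < u j by rewrite exprn_gt0// invr_gt0.
have uS j : u j.+1 = u j / 2 by rewrite /u exprSr.
have u_le i j : (i <= j)%N -> u j <= u i.
  move=> /subnK <-; elim: (j - i)%N => [|k IH]; first by rewrite add0n.
  by rewrite addSn uS; have := u0 (k + i)%N; lra.
have u_half j : u j <= 2^-1.
  by apply: (le_trans (u_le 0%N j _)) => //; rewrite /u expr1.
have ballc j x i : eball (c j) (u j / 4) x ->
    `|x 0 i - (if i == ord0 then u j else 2^-1)| < u j / 4.
  by move=> /(@eball_coord _ _ _ _ _ i); rewrite mxE.
have ball0 j x : eball (c j) (u j / 4) x -> 3 / 4 * u j < x 0 ord0 < 5 / 4 * u j.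
  move=> xB; have := ballc _ _ ord0 xB; rewrite eqxx ltr_norml => /andP[h1 h2].
  by apply/andP; split; lra.
have u_cvg : u j @[j --> \oo] --> 0.
  have h : 2^-1 ^+ j * 2^-1 @[j --> \oo] --> (0 * 2^-1 : R).
    apply: cvgM; last exact: cvg_cst.
    by apply: cvg_expr; rewrite ger0_norm ?invr_ge0// invf_lt1// ltr1n.
  by move: h; rewrite mul0r; under eq_fun do rewrite -exprSr.
exists c, (fun j => u j / 4); split.
- by move=> j; rewrite divr_gt0.
- have lt_disj i j x : (i < j)%N -> eball (c i) (u i / 4) x ->
      eball (c j) (u j / 4) x -> False.
    move=> ij /ball0/andP[h1 h2] /ball0/andP[h3 h4].
    have := u_le _ _ ij; rewrite uS; have := u0 i; lra.
  move=> i j _ _ [x [xi xj]]; case: (ltngtP i j) => // ij.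
    by have := lt_disj _ _ _ ij xi xj.
  by have := lt_disj _ _ _ ij xj xi.
- have h : u j * 4^-1 @[j --> \oo] --> (0 * 4^-1 : R).
    by apply: cvgM => //; exact: cvg_cst.
  by move: h; rewrite mul0r.
- move=> j x xB i; have := ballc _ _ i xB; have := u_half j; have := u0 j.
  move=> h0 h1; case: ifP => _; rewrite ltr_norml => /andP[h2 h3];
  by apply/andP; split; lra.
move=> y /nbhs_ballP[e /= e0 He].
have y0 : 0 < y 0 ord0.
  have : @cube R m.+2 (y - (e / 2) *: delta_mx 0 ord0).
    apply: He; split=> // i k; rewrite /ball/= !mxE opprB addrC subrK.
    case: (_ && _); rewrite ?mulr1 ?mulr0 ?normr0//.
    by rewrite gtr0_norm; lra.
  by move=> /(_ ord0); rewrite !mxE !eqxx /= => /andP[h _]; lra.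
exists [set z | y 0 ord0 / 2 < z 0 ord0].
  have hy : y 0 ord0 / 2 < y 0 ord0 by lra.
  exact: (@coord_continuous R 1 m.+2 0 ord0 y _ (lt_nbhsr hy)).
have y25 : 0 < 2 / 5 * y 0 ord0 by lra.
have [N _ HN] := (cvgr0Pnorm_le u).1 u_cvg _ y25.
apply: (sub_finite_set _ (finite_II N)) => j [z [zB /= zy]] /=.
rewrite ltnNge; apply/negP => Nj.
have := HN j Nj; rewrite /= gtr0_norm// => h.
have /andP[_ h2] := ball0 _ _ zB; lra.
Qed.

Lemma H1_nonzero_inhabited (R : realType) (T : topologicalType) :
  H1_nonzero R T -> inhabited T.
Proof.
move=> [[|s z] [_ _ nb]]; last by exists; exact: (s.2 0).
by case: (nb [::]).
Qed.

Section AffineEmbedding.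
Context {R : realType} {d n : nat} (M : riemannian_manifold R d.+1).
Variables (iota : M -> 'rV[R]_n) (a : R) (b : 'rV[R]_n).
Hypotheses (emb : smooth_embedding iota) (a0 : a != 0).

Let f p := a *: iota p + b.

(** A derivative in charts exists because the jacobian of an embedding has full,
    hence nonzero, rank, while a missing derivative would be recorded as 0. *)
Lemma affine_embedding :
  [/\ continuous f, injective f,
      forall U : set M, open U ->
        exists2 V : set 'rV[R]_n, open V & f @` U = V `&` range f &
      forall c p, atlas c -> chart_dom c p ->
        derivative_within (chart_img c) (f \o chart_inv c) (chart_map c p)
          (chart_jacobian f c p)].
Proof.
case: emb => ci ii oi _ rk.
pose g (z : 'rV[R]_n) := a^-1 *: (z - b).
have cg : continuous g.
  apply: elementary_row_continuous => i.
  rewrite (_ : (fun z => _) = fun z : 'rV[R]_n => a^-1 * (z 0 i - b 0 i)).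
    apply: elementaryM; first exact: elementary_cst.
    by apply: elementaryB; [exact: elementary_coord|exact: elementary_cst].
  by apply/funext => z; rewrite !mxE.
have fK p : g (f p) = iota p by rewrite /g /f addrK scalerA mulVf// scale1r.
split.
- move=> p; apply: cvgD; last exact: cvg_cst.
  by apply: cvgZ; [exact: cvg_cst|exact: ci].
- by move=> p q /(congr1 g); rewrite !fK; exact: ii.
- move=> U /oi[V oV E]; exists (g @^-1` V).
    by apply: open_comp => // z _; exact: cg.
  apply/seteqP; split=> [_ [p Up <-]|z [/= Vz [p _ pz]]].
    split; last by exists p.
    have [] : (V `&` range iota) (iota p) by rewrite -E; exists p.
    by rewrite /= fK.
  have [q Uq qp] : (iota @` U) (iota p).
    by rewrite E; split; [rewrite -fK pz|exists p].
  by exists q => //; rewrite -pz /f qp.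
- move=> c p ac cp; apply: (@jacobian_within_ex _ _ _ _ _ _
    (a *: chart_jacobian iota c p)).
  apply: (derivative_within_affine b a0); apply: jacobian_within_neq0.
  by apply/negP => /eqP J0; have := rk c p ac cp; rewrite /chart_jacobian J0 mxrank0.
Qed.

End AffineEmbedding.

Theorem theorem1p3 (R : realType) :
  (forall n : nat, (3 <= n)%N ->
     exists xi eta : R -> 'rV[R]_n -> 'rV[R]_n, infinite_finite_pair xi eta)
  /\
  (forall (d n : nat) (M : riemannian_manifold R d) (iota : M -> 'rV[R]_n)
     (rho delta a : nat -> R) (x b : nat -> 'rV[R]_n),
     compact [set: M] ->
     (3 <= d)%N ->
     H1_nonzero R M ->
     (forall p : M, pi1_trivial_centre R p) ->
     (d <= n)%N ->
     smooth_embedding iota ->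
     isometric iota ->
     (forall j, 0 < rho j) ->
     rho j @[j --> \oo] --> 0 ->
     (forall j, cube (x j)) ->
     trivIset [set: nat] (fun j => eball (x j) (rho j)) ->
     (forall j, eball (x j) (rho j) `<=` @cube R n) ->
     (forall y, (@cube R n)^° y -> exists2 U, nbhs y U &
        finite_set [set j | eball (x j) (rho j) `&` U !=set0]) ->
     (forall j, a j != 0) ->
     let iota_ j p := a j *: iota p + b j in
     (forall j p, eball (x j) (rho j / 2) (iota_ j p)) ->
     (forall j, 0 < delta j < rho j / 4) ->
     (forall j, tube_embedded (iota_ j) (delta j)) ->
     exists xi eta : R -> 'rV[R]_n -> 'rV[R]_n,
       [/\ infinite_finite_pair xi eta,
           supported_on xi (\bigcup_j tube (iota_ j) (delta j)) &
           forall j,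
             (forall t, 0 <= t <= 1 ->
                exists2 y, eball (x j) (rho j) y & velocity xi t y <> 0) /\
             (forall s t, 0 <= s -> s < t -> t <= 1 ->
                exists2 y, eball (x j) (rho j) y & xi s y <> xi t y)]).
Proof.
split.
  move=> [|[|m]] // _.
  have [c [r [r0 dis rc sub lf]]] := disjoint_balls_in_cube R m.
  have [xi [eta [h _ _]]] := twisting_balls r0 dis rc sub lf.
  by exists xi, eta.
move=> [//|d] [|[|m]] M iota rho delta a x b cM d3 H1 _ dn emb _ rho0 rho_cvg _.
all: try by move: (leq_trans d3 dn).
move=> dis sub lf a0 iota_ iota_ball delta_rho _.
have [q] := H1_nonzero_inhabited H1.
have small j : exists cr : 'rV[R]_m.+2 * R, [/\ 0 < cr.2, cr.2 <= rho j,
    eball cr.1 cr.2 `<=` tube (iota_ j) (delta j) &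
    eball cr.1 cr.2 `<=` eball (x j) (rho j)].
  have [cf inj_f emb_f df] := affine_embedding (b j) emb (a0 j).
  have /andP[delta0 _] := delta_rho j.
  have [p [r [r0 sub_r]]] := tube_contains_eball q cM cf inj_f emb_f df delta0.
  have in_ball : eball (x j) (rho j) (iota_ j p).
    by apply: lt_trans (iota_ball j p) _; have := rho0 j; lra.
  have : nbhs (iota_ j p) (eball (x j) (rho j)).
    by apply: open_nbhs_nbhs; split=> //; exact: open_eball.
  move=> /nbhs_ballP[e /= e0 He].
  exists (iota_ j p, Num.min r (Num.min e (rho j))); split=> /=.
  - by rewrite !lt_min r0 e0 rho0.
  - by rewrite !ge_min lexx !orbT.
  - by move=> y yB; apply: sub_r; apply: lt_le_trans yB _; rewrite ge_min lexx.
  - move=> y yB; apply: He; split=> // i k; rewrite (ord1 i) /ball/= distrC.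
    apply: lt_le_trans (eball_coord k yB) _.
    by rewrite !ge_min lexx orbT.
have [cr Hcr] := choice small.
have [] := @twisting_balls R m (fun j => (cr j).1) (fun j => (cr j).2).
- by move=> j; have [] := Hcr j.
- move=> i j _ _ [y [yi yj]]; apply: dis => //; exists y.
  by split; [have [_ _ _] := Hcr i|have [_ _ _] := Hcr j]; apply.
- apply: (@squeeze_cvgr _ _ _ _ (fun=> 0) rho); last exact: rho_cvg.
    by near=> j; have [/ltW -> -> _ _] := Hcr j.
  exact: cvg_cst.
- by move=> j y yB; apply: (sub j); have [_ _ _] := Hcr j; apply.
- move=> y /lf[U Uy finU]; exists U => //; apply: sub_finite_set finU.
  by move=> j /= [z [zB Uz]]; exists z; split=> //; have [_ _ _] := Hcr j; apply.
move=> xi [eta [pair supp move_]]; exists xi, eta; split=> //.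
  move=> t y t01 Cy ntube; apply: supp => // -[j _ yB]; apply: ntube.
  by exists j => //; have [_ _ + _] := Hcr j; apply.
move=> j; have [_ _ _ inB] := Hcr j; have [vel ret] := move_ j; split.
  by move=> t t01; have [y yB hy] := vel t t01; exists y => //; exact: inB.
move=> s t s0 st t1; have [y yB hy] := ret s t s0 st t1.
by exists y => //; exact: inB.
Unshelve. all: by end_near. Qed.
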